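(* For every $\rho<1$ there exists $L>0$ such that the following holds. If $G$ is a transitive graph with spectral radius at most $\rho$ and girth at least $L$, then the self-avoiding walk bubble condition holds: $$\lim_{z\to\mu^{-1}}\sum_{x\in G}G_z(x)^2<\infty,$$ and consequently the self-avoiding walk exponent $\gamma$ equals $1$.
   Context: Graphs are connected, locally finite and infinite, with origin $0$. The spectral radius is $\lim_n p^{2n}(0,0)^{1/(2n)}$ for the simple random walk transition probabilities $p^n$; the girth is the length of the shortest cycle. $c_n$ is the number of self-avoiding (simple) paths of length $n$ starting at $0$, $c_n(x)$ the number of those ending at $x$, and $\mu=\lim_n c_n^{1/n}$ (the connective constant). For $z\in[0,\mu^{-1})$, $G_z(x)=\sum_{n\ge0}c_n(x)z^n$. The exponent $\gamma$ is defined by $\gamma=\lim_{n\to\infty}\frac{\log(c_n\mu^{-n})}{\log n}+1$. *)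

(* Defs.v *)
From HB Require Import structures.
From mathcomp Require Import all_boot all_order all_algebra.
From mathcomp Require Import all_classical all_reals all_analysis.
Set Implicit Arguments. Unset Strict Implicit. Unset Printing Implicit Defensive.
Import Order.TTheory GRing.Theory Num.Theory.
Import numFieldNormedType.Exports.
Local Open Scope classical_set_scope.
Local Open Scope ring_scope.

Section Graph.
Variables (V : choiceType) (nbrs : V -> seq V).

Definition adj : rel V := fun x y => y \in nbrs x.

(* simple, undirected, locally finite (neighbour lists are finite by construction) *)
Definition simple_graph : Prop :=
  (forall x, uniq (nbrs x)) /\ (forall x, x \notin nbrs x) /\
  (forall x y, y \in nbrs x -> x \in nbrs y).

Definition connected_graph : Prop :=
  forall x y : V, exists p : seq V, path adj x p /\ last x p = y.

Definition infinite_graph : Prop := forall s : seq V, exists x, x \notin s.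

Definition graph_automorphism (f : V -> V) : Prop :=
  bijective f /\ forall a b, adj (f a) (f b) = adj a b.

Definition transitive_graph : Prop :=
  forall x y : V, exists f : V -> V, graph_automorphism f /\ f x = y.

Definition girth_ge (L : nat) : Prop :=
  forall c : seq V, (3 <= size c)%N -> uniq c -> cycle adj c -> (L <= size c)%N.

Fixpoint srw_p {R : realType} (n : nat) (x y : V) : R :=
  match n with
  | 0 => (x == y)%:R
  | n'.+1 => \sum_(w <- nbrs x) (size (nbrs x))%:R^-1 * srw_p n' w y
  end.

Definition spectral_radius {R : realType} (o : V) : R :=
  lim ((fun n : nat => (srw_p (2 * n) o o : R) `^ ((2 * n)%:R^-1)) @ \oo).

Fixpoint walks_from (n : nat) (x : V) : seq (seq V) :=
  match n with
  | 0 => [:: [:: x]]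
  | n'.+1 => flatten [seq [seq x :: w | w <- walks_from n' y] | y <- nbrs x]
  end.

Definition saw_count (o : V) (n : nat) : nat := count uniq (walks_from n o).

Definition saw_count_to (o : V) (n : nat) (x : V) : nat :=
  count (fun w => uniq w && (last o w == x)) (walks_from n o).

Definition connective_constant {R : realType} (o : V) : R :=
  lim ((fun n : nat => ((saw_count o n)%:R : R) `^ (n%:R^-1)) @ \oo).

Definition saw_green {R : realType} (o : V) (z : R) (x : V) : \bar R :=
  (\sum_(0 <= n <oo) (((saw_count_to o n x)%:R * z ^+ n)%:E))%E.

Definition saw_bubble {R : realType} (o : V) (z : R) : \bar R :=
  (\esum_(x in [set: V]) (saw_green o z x * saw_green o z x))%E.

Definition saw_bubble_condition {R : realType} (o : V) : Prop :=
  exists l : R,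
    saw_bubble o z @[z --> ((connective_constant o : R)^-1)^'-] --> l%:E.

Definition saw_gamma_is {R : realType} (o : V) (g : R) : Prop :=
  (fun n : nat => ln ((saw_count o n)%:R / (connective_constant o : R) ^+ n)
                    / ln (n%:R) + 1) @ \oo --> g.
End Graph.

(* Main.v *)
(** Self-avoiding walks are nonbacktracking.  If [g] is the generating function of
    nonbacktracking walks ending at [v], weighted by [s ^ length], then on a [d]-regular
    graph [(1 + (d - 1) s^2) g = s A g + (1 - s^2) delta_v], so [g] is dominated by the
    Green function of the simple random walk at [t = s d / (1 + (d - 1) s^2)].  For
    [s = 1 / (a (d - 1))] with [rho < a < 1] one has [t rho < 1], and both the number of
    nonbacktracking loops and the bubble diagram are controlled at [s].  When two
    self-avoiding walks are concatenated, either they backtrack at the junction or they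
    close a nonbacktracking loop of length at least the girth; for large girth the latter
    are negligible, uniformly in [d].  Hence [c (n + 1) >= b (d - 1) c n] with
    [a < b < 1], so that [1 / mu < s] and the bubble converges, and also
    [c m * c n <= 6 c (m + n)], so that [mu ^ n <= c n <= 6 mu ^ n] and [gamma = 1]. *)

Require Import Defs.
From HB Require Import structures.
From mathcomp Require Import all_boot all_order all_algebra.
From mathcomp Require Import all_classical all_reals all_analysis.
From mathcomp Require Import zify ring lra.
Set Implicit Arguments. Unset Strict Implicit. Unset Printing Implicit Defensive.
Import Order.TTheory GRing.Theory Num.Theory.
Import numFieldNormedType.Exports.
Local Open Scope classical_set_scope.
Local Open Scope ring_scope.

(** * Subadditive sequences *)

Lemma ler_of_eq (R : numDomainType) (x y : R) : x = y -> x <= y.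
Proof. by move->. Qed.

Lemma cvg_divn (R : realType) (K : R) : (fun n => K / n%:R) @ \oo --> (0 : R).
Proof.
rewrite -[X in _ --> X](mulr0 K); apply: cvgMl_tmp.
by rewrite -cvg_shiftS; exact: cvg_harmonic.
Qed.

(** The limit is the infimum of [a n / n%:R] over positive [n]. Dividing [n] by a near-optimal [k],
    the quotient contributes at rate [a k / k%:R] and the remainder at most the constant [M], which
    disappears after division by [n]. *)
Lemma fekete (R : realType) (a : nat -> R) :
  (forall n, 0 <= a n) -> (forall m n, a (m + n)%N <= a m + a n) ->
  exists l : R, (fun n => a n / n%:R) @ \oo --> l /\ forall n, n%:R * l <= a n.
Proof.
move=> a0 aD.
pose E := [set a n / n%:R | n in [set n | (0 < n)%N]].
have E0 : lbound E 0 by move=> _ [n _ <-]; rewrite divr_ge0.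
have hE : has_inf E by split; [exists (a 1%N / 1%:R), 1%N|exists 0].
exists (inf E); split; last first.
  case=> [|n]; first by rewrite mul0r.
  rewrite mulrC -ler_pdivlMr ?ltr0n//; apply: ge_inf; first by exists 0.
  by exists n.+1.
have mul_le q k r : a (q * k + r)%N <= q%:R * a k + a r.
  elim: q => [|q IH]; first by rewrite mul0n add0n mul0r add0r.
  rewrite mulSn -addnA (le_trans (aD _ _))// -natr1 mulrDl mul1r; lra.
apply/cvgrPdist_le => e e0.
have e20 : 0 < e / 2 by rewrite divr_gt0.
have [_ [k /= k0 <-] hk] := inf_adherent e20 hE.
pose M := \sum_(r < k) a r.
have hM r : (r < k)%N -> a r <= M.
  move=> rk; rewrite /M (bigD1 (Ordinal rk))//= lerDl sumr_ge0//.
have := @cvg_divn _ M; move/cvgrPdist_le => /(_ _ e20)[N _ hN].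
exists N.+1 => // n /= Nn.
have n0 : (0 < n)%N by apply: leq_trans Nn.
have n0R : (0 : R) < n%:R by rewrite ltr0n.
have hl : inf E <= a n / n%:R by apply: ge_inf; [exists 0|exists n].
rewrite distrC ger0_norm ?subr_ge0//.
have := hN n (ltnW Nn); rewrite /= sub0r normrN ger0_norm; last first.
  by rewrite divr_ge0// sumr_ge0.
move=> hMn.
have := mul_le (n %/ k)%N k (n %% k)%N; rewrite -divn_eq => han.
have hr := hM _ (ltn_pmod n k0).
suff : a n / n%:R <= a k / k%:R + M / n%:R by lra.
rewrite ler_pdivrMr// mulrDl divfK ?gt_eqF//.
apply: (le_trans han); apply: lerD => //.
have : ((n %/ k)%N%:R : R) * k%:R <= n%:R by rewrite -natrM ler_nat leq_divM.
have kR : (0 : R) < k%:R by rewrite ltr0n.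
rewrite -ler_pdivlMr// => h.
by rewrite -mulrA [leRHS]mulrC ler_wpM2r// mulrC.
Qed.

(** The sequence [a - K] is superadditive, so along the multiples of [n] its rate [l] dominates
    [(a n - K) / n%:R]. *)
Lemma superadditive_le_rate (R : realType) (a : nat -> R) (K l : R) :
  (forall m n, a m + a n <= a (m + n)%N + K) ->
  (fun n => a n / n%:R) @ \oo --> l -> forall n, a n <= n%:R * l + K.
Proof.
move=> aD al n.
have mul_le k : k.+1%:R * (a n - K) <= a (k.+1 * n)%N - K.
  elim: k => [|k IH]; first by rewrite mul1n mul1r.
  rewrite mulSn -natr1 mulrDl mul1r.
  have := aD n (k.+1 * n)%N; lra.
case: n => [|n] in mul_le *.
  have := aD 0%N 0%N; rewrite mul0r/=; lra.
have cv : (fun k => a (k.+1 * n.+1)%N / (k.+1 * n.+1)%:R) @ \oo --> l.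
  apply: cvg_comp al => //.
  move=> P [N _ hN]; exists N => // k /= Nk; apply: hN => /=.
  by rewrite (leq_trans Nk)// (leq_trans (leqnSn k))// leq_pmulr.
have cvK : (fun k => `|K| / k%:R) @ \oo --> (0 : R) := @cvg_divn _ _.
have {}cvK : (fun k => `|K| / (k.+1)%:R) @ \oo --> (0 : R).
  by move: cvK; rewrite -cvg_shiftS.
have cvs : (fun k => a (k.+1 * n.+1)%N / (k.+1 * n.+1)%:R + `|K| / (k.+1)%:R)
    @ \oo --> l by rewrite -[l]addr0; exact: cvgD.
suff : (a n.+1 - K) / n.+1%:R <= l.
  by rewrite ler_pdivrMr ?ltr0n// mulrC; lra.
have /(limr_ge (cvgP _ cvs)) : \forall k \near \oo, (a n.+1 - K) / n.+1%:R <=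
    a (k.+1 * n.+1)%N / (k.+1 * n.+1)%:R + `|K| / (k.+1)%:R.
  near=> k; rewrite /=.
  have k0 : (0 : R) < k.+1%:R by rewrite ltr0n.
  have n0 : (0 : R) < n.+1%:R by rewrite ltr0n.
  have -> : (a n.+1 - K) / n.+1%:R = k.+1%:R * (a n.+1 - K) / (k.+1 * n.+1)%:R.
    by rewrite natrM; field; rewrite !gt_eqF.
  have -> : `|K| / k.+1%:R = n.+1%:R * `|K| / (k.+1 * n.+1)%:R.
    by rewrite natrM; field; rewrite !gt_eqF.
  rewrite -mulrDl ler_pM2r ?invr_gt0 ?ltr0n//.
  apply: (le_trans (mul_le k)); rewrite lerD2l.
  apply: (@le_trans _ _ `|K|); first by rewrite -normrN ler_norm.
  by rewrite ler_peMl// ler1n.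
by rewrite (cvg_lim _ cvs).
Unshelve. all: by end_near. Qed.

(** * Nonbacktracking walks *)

Section Walks.
Variables (V : choiceType) (nbrs : V -> seq V).
Notation walks := (walks_from nbrs).

Lemma count_sum (T : Type) (P : pred T) (s : seq T) :
  count P s = (\sum_(w <- s) P w)%N.
Proof. by elim: s => [|w s IH]; rewrite ?big_nil ?big_cons //= IH. Qed.

Lemma mem_walks n x w : w \in walks n x ->
  exists p, [/\ w = x :: p, size p = n & path (adj nbrs) x p].
Proof.
elim: n x w => [|n IH] x w; first by rewrite inE => /eqP ->; exists [::].
move=> /= /flatten_mapP[y xy /mapP[v /IH[p [-> sp yp]] ->]].
by exists (y :: p); rewrite /= sp yp andbT.
Qed.

Lemma walks_mem x p : path (adj nbrs) x p -> x :: p \in walks (size p) x.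
Proof.
elim: p x => [|y p IH] x /=; first by rewrite inE.
move=> /andP[xy /IH yp]; apply/flatten_mapP; exists y => //.
exact: map_f.
Qed.

Section Sums.
Variables (T : Type) (idx : T) (op : Monoid.com_law idx).

Lemma big_walksS n x (F : seq V -> T) :
  \big[op/idx]_(w <- walks n.+1 x) F w =
  \big[op/idx]_(y <- nbrs x) \big[op/idx]_(w <- walks n y) F (x :: w).
Proof. by rewrite /= big_flatten big_map; apply: eq_bigr => y _; rewrite big_map. Qed.

Lemma big_walks0 x (F : seq V -> T) : \big[op/idx]_(w <- walks 0 x) F w = F [:: x].
Proof. by rewrite /= big_seq1. Qed.

(** The junction vertex is the last of [u] and the first of [v]; [behead] keeps it from appearing
    twice. *)
Lemma big_walksD m n x (F : seq V -> T) :
  \big[op/idx]_(w <- walks (m + n) x) F w =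
  \big[op/idx]_(u <- walks m x) \big[op/idx]_(v <- walks n (last x u)) F (u ++ behead v).
Proof.
elim: m x F => [|m IH] x F.
  rewrite add0n big_walks0 /= ; apply: eq_big_seq => w.
  case: n => [|n]; first by rewrite inE => /eqP ->.
  by move=> /= /flatten_mapP[y _ /mapP[v _ ->]].
rewrite addSn !big_walksS; apply: eq_bigr => y _; rewrite IH.
by apply: eq_big_seq => u /mem_walks[p [-> _ _]].
Qed.
End Sums.


Fixpoint nonbacktracking (w : seq V) : bool :=
  if w is x :: w' then
    (if w' is _ :: y :: _ then x != y else true) && nonbacktracking w'
  else true.

Section NonBacktracking.
Variables (R : realType) (d : nat) (f : V -> R).
Hypothesis simpleG : simple_graph nbrs.
Hypothesis regG : forall x, size (nbrs x) = d.
Hypothesis f0 : forall x, 0 <= f x.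
Local Notation q := (d.-1%:R : R).

(** With [f] the indicator of a vertex [v], this is the number of nonbacktracking walks of length
    [n] from [x] to [v]. *)
Definition nbsum n x : R := \sum_(w <- walks n x | nonbacktracking w) f (last x w).

(** The predecessor [y] only forbids a first step that returns to it. *)
Let nbfrom n y x : R := \sum_(w <- walks n x | nonbacktracking (y :: w)) f (last x w).

Lemma nbsum_ge0 n x : 0 <= nbsum n x.
Proof. exact: sumr_ge0. Qed.

Lemma nbsum0 x : nbsum 0 x = f x.
Proof. by rewrite /nbsum big_mkcond big_walks0. Qed.

Let nbsumS n x : nbsum n.+1 x = \sum_(z <- nbrs x) nbfrom n x z.
Proof.
rewrite /nbsum big_mkcond big_walksS; apply: eq_bigr => z _.
by rewrite /nbfrom [RHS]big_mkcond; apply: eq_big_seq => w /mem_walks[p [-> _ _]].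
Qed.

Let nbfrom0 y x : nbfrom 0 y x = f x.
Proof. by rewrite /nbfrom big_mkcond big_walks0. Qed.

Let nbfromS n y x : nbfrom n.+1 y x = \sum_(z <- nbrs x | y != z) nbfrom n x z.
Proof.
rewrite /nbfrom big_mkcond big_walksS [RHS]big_mkcond; apply: eq_bigr => z _.
case: (y =P z) => [->|/eqP yz] /=.
  by rewrite big1_seq// => w /andP[_ /mem_walks[p [-> _ _]]]; rewrite /= eqxx.
by rewrite [RHS]big_mkcond; apply: eq_big_seq => w /mem_walks[p [-> _ _]]; rewrite /= yz.
Qed.

(** After prepending [x] to a walk from a neighbour [y], either the result is nonbacktracking, or
    the walk returns to [x] at once and goes on avoiding [y]. In the second case a continuation with
    first step [z] arises from the [d - 1] neighbours [y] other than [z]; an empty continuation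
    arises from all [d], whence only an inequality. *)
Lemma sum_nbsumS n x :
  \sum_(y <- nbrs x) nbsum n.+1 y >= nbsum n.+2 x + q * nbsum n x.
Proof.
have [uG [_ sG]] := simpleG.
have -> : \sum_(y <- nbrs x) nbsum n.+1 y =
    nbsum n.+2 x + \sum_(y <- nbrs x) nbfrom n y x.
  rewrite nbsumS -big_split/=; apply: eq_big_seq => y xy.
  rewrite nbsumS (bigD1_seq x)//=; last exact: sG.
  by rewrite addrC nbfromS; congr (_ + _); apply: eq_bigl => z; rewrite eq_sym.
rewrite lerD2l; case: n => [|n].
  under eq_bigr do rewrite nbfrom0.
  rewrite big_const_seq count_predT iter_addr_0 regG nbsum0 mulr_natl.
  by apply: ler_wpMn2l => //; exact: leq_pred.
under eq_bigr do rewrite nbfromS big_mkcond/=.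
rewrite exchange_big/= nbsumS mulr_sumr le_eqVlt; apply/orP; left.
apply/eqP/eq_big_seq => z xz; apply/esym.
rewrite -big_mkcond/= big_const_seq iter_addr_0 mulr_natl.
congr (_ *+ _).
have := count_predC (pred1 z) (nbrs x).
by rewrite count_uniq_mem// xz regG add1n => <-.
Qed.

Lemma nbsum1 x : nbsum 1 x = \sum_(y <- nbrs x) f y.
Proof. by rewrite nbsumS; apply: eq_bigr => y _. Qed.

End NonBacktracking.
End Walks.

(** * Comparison with the random walk Green function *)

Section Averaging.
Variables (V : choiceType) (nbrs : V -> seq V) (R : realType).

Definition avg (g : V -> R) (x : V) : R :=
  \sum_(w <- nbrs x) (size (nbrs x))%:R^-1 * g w.

Local Notation avgn n := (iter n avg).

Lemma srw_pE n x y : srw_p nbrs n x y = avgn n (fun z => (z == y)%:R) x.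
Proof. by elim: n x => //= n IH x; apply: eq_bigr => w _; rewrite IH. Qed.

Lemma avgn_le n (g h : V -> R) : (forall x, g x <= h x) ->
  forall x, avgn n g x <= avgn n h x.
Proof.
move=> gh; elim: n => //= n IH x.
by apply: ler_sum => w _; apply: ler_wpM2l; rewrite ?invr_ge0.
Qed.

Lemma avgn_ge0 n (g : V -> R) : (forall x, 0 <= g x) -> forall x, 0 <= avgn n g x.
Proof.
move=> g0; elim: n => //= n IH x.
by apply: sumr_ge0 => w _; rewrite mulr_ge0 ?invr_ge0.
Qed.

Lemma avgnZD n a b (g h : V -> R) x :
  avgn n (fun x => a * g x + b * h x) x = a * avgn n g x + b * avgn n h x.
Proof.
elim: n x => //= n IH x; rewrite /avg !mulr_sumr -big_split/=.
by apply: eq_bigr => w _; rewrite IH; ring.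
Qed.

Lemma avgn_sum n (I : Type) (s : seq I) (c : I -> R) (h : I -> V -> R) x :
  avgn n (fun x => \sum_(i <- s) c i * h i x) x = \sum_(i <- s) c i * avgn n (h i) x.
Proof.
elim: n x => //= n IH x.
transitivity (avg (fun y => \sum_(i <- s) c i * avgn n (h i) y) x).
  by apply: eq_bigr => w _; rewrite IH.
rewrite {1}/avg; under eq_bigr do rewrite mulr_sumr.
rewrite exchange_big/=; apply: eq_bigr => i _; rewrite mulr_sumr.
by apply: eq_bigr => w _; rewrite mulrCA.
Qed.

(** The hypothesis is substituted into itself [M] times, [avg] being monotone. The remainder stays
    explicit, as [g] need not be bounded. *)
Lemma subsolution_iter (t k : R) (f g : V -> R) : 0 <= t ->
  (forall x, g x <= t * avg g x + k * f x) -> forall M x,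
  g x <= k * (\sum_(N < M) t ^+ N * avgn N f x) + t ^+ M * avgn M g x.
Proof.
move=> t0 gle; elim=> [|M IH] x; first by rewrite big_ord0 mulr0 add0r mul1r.
apply: (le_trans (IH x)); rewrite big_ord_recr/= mulrDr -addrA lerD2l.
apply: (@le_trans _ _ (t ^+ M * avgn M (fun x => t * avg g x + k * f x) x)).
  by apply: ler_wpM2l; [exact: exprn_ge0|exact: avgn_le].
by rewrite avgnZD -iterSr exprS -iterS; apply/ler_of_eq; ring.
Qed.

Section Comparison.
Variables (d : nat) (f : V -> R).
Hypothesis simpleG : simple_graph nbrs.
Hypothesis regG : forall x, size (nbrs x) = d.
Hypothesis d0 : (0 < d)%N.
Hypothesis f0 : forall x, 0 <= f x.
Variable s : R.
Hypothesis s0 : 0 <= s.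
Local Notation q := (d.-1%:R : R).
Hypothesis qs1 : q * s ^+ 2 <= 1.
Local Notation beta n x := (s ^+ n * nbsum nbrs f n x).
Local Notation S J x := (\sum_(n < J) beta n x).
Local Notation b K x := (\sum_(j < K) S j.+1 x).

Lemma sum_nbrsE (g : V -> R) x : \sum_(w <- nbrs x) g w = d%:R * avg g x.
Proof.
rewrite /avg mulr_sumr; apply: eq_bigr => w _.
by rewrite regG mulrA mulfV ?mul1r// pnatr_eq0 -lt0n.
Qed.

Lemma beta_ge0 n x : 0 <= beta n x.
Proof. by rewrite mulr_ge0 ?exprn_ge0 ?nbsum_ge0. Qed.

Lemma nbsum_le_avgn n x : nbsum nbrs f n x <= d%:R ^+ n * avgn n f x.
Proof.
(* The recursion only produces lengths from two on, so lengths 0 and 1 are both base cases. *)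
suff : forall n, (forall x, nbsum nbrs f n x <= d%:R ^+ n * avgn n f x) /\
   (forall x, nbsum nbrs f n.+1 x <= d%:R ^+ n.+1 * avgn n.+1 f x).
  by move=> /(_ n)[].
have avgE (g : V -> R) m y : (forall y, g y <= d%:R ^+ m * avgn m f y) ->
    \sum_(z <- nbrs y) g z <= d%:R ^+ m.+1 * avgn m.+1 f y.
  move=> hg; rewrite sum_nbrsE exprS -mulrA ler_wpM2l//.
  apply: (le_trans (@avgn_le 1 _ _ hg y)) => /=.
  rewrite /avg mulr_sumr; apply/ler_of_eq/eq_bigr => w _; exact: mulrCA.
elim=> [|m [IH1 IH2]]; split=> // y.
- by rewrite nbsum0 mul1r.
- by rewrite nbsum1; apply: (@avgE f 0%N) => z; rewrite mul1r.
- apply: le_trans (avgE _ _ y IH2).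
  apply: le_trans (sum_nbsumS simpleG regG f0 m y).
  by rewrite lerDl mulr_ge0// nbsum_ge0.
Qed.

(* For the operator [1 - s A + q s^2], whose image of the generating function of
   nonbacktracking walks is [(1 - s^2) f], the partial sum [S] is a subsolution up to
   boundary terms; these telescope in the Cesaro sum [b]. *)
Lemma partial_sum_subsolution j x :
  (1 + q * s ^+ 2) * S j.+1 x - s * (\sum_(y <- nbrs x) S j.+1 y)
    <= f x + q * s ^+ 2 * beta j x - beta j.+1 x.
Proof.
have sumE i : \sum_(y <- nbrs x) S i.+1 y =
    \sum_(y <- nbrs x) S i y + s ^+ i * \sum_(y <- nbrs x) nbsum nbrs f i y.
  by rewrite mulr_sumr -big_split; apply: eq_bigr => y _; rewrite big_ord_recr.
elim: j => [|j IH].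
  have e : \sum_(y <- nbrs x) nbsum nbrs f 0 y = nbsum nbrs f 1 x.
    by rewrite nbsum1; apply: eq_bigr => y _; rewrite nbsum0.
  rewrite sumE e big_ord_recr !big_ord0 /= nbsum0 [\sum_(y <- _) _]big1; last first.
    by move=> y _; rewrite big_ord0.
  by rewrite !add0r; apply/ler_of_eq; ring.
rewrite sumE big_ord_recr/=.
have := sum_nbsumS simpleG regG f0 j x; set A := \sum_(y <- _) nbsum _ _ _ _ => hA.
have : s ^+ j.+2 * (nbsum nbrs f j.+2 x + q * nbsum nbrs f j x) <= s ^+ j.+2 * A.
  by rewrite ler_wpM2l// exprn_ge0.
move: IH; rewrite !exprS; set s2 := \sum_(y <- _) _; set s1 := \sum_(i < _) _.
set B0 := nbsum _ _ j _; set B1 := nbsum _ _ j.+1 _; set B2 := nbsum _ _ j.+2 _.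
move: (s ^+ j) => u; rewrite expr0; lra.
Qed.

(** In the sum over [j], each negative boundary term [beta j.+1] absorbs the next
    [q * s ^+ 2 * beta j.+1] because of [qs1]. The first positive one is paid by the extra copy of
    [f], and the final [- beta K] is discarded. *)
Lemma cesaro_subsolution K x :
  b K x <= s * d%:R / (1 + q * s ^+ 2) * avg (fun y => b K y) x + K.+1%:R * f x.
Proof.
have c0 : 0 <= q * s ^+ 2 by rewrite mulr_ge0// exprn_ge0.
have c1 : 0 < 1 + q * s ^+ 2 by lra.
suff h : (1 + q * s ^+ 2) * b K x - s * (\sum_(y <- nbrs x) b K y) <=
    K.+1%:R * f x - beta K x.
  rewrite sum_nbrsE in h.
  have clear c A B : 0 < c -> c * (s * d%:R / c * A + B) = s * (d%:R * A) + c * B.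
    by move=> c_gt0; field; rewrite gt_eqF.
  rewrite -(ler_pM2l c1) clear//.
  have := beta_ge0 K x => hb.
  have : 0 <= q * s ^+ 2 * (K.+1%:R * f x) by rewrite mulr_ge0// mulr_ge0.
  lra.
elim: K => [|K IH].
  rewrite big_ord0 [\sum_(y <- _) _]big1 ?nbsum0; last by move=> y _; rewrite big_ord0.
  by apply/ler_of_eq; ring.
have -> : \sum_(y <- nbrs x) b K.+1 y =
    \sum_(y <- nbrs x) b K y + \sum_(y <- nbrs x) S K.+1 y.
  by rewrite -big_split; apply: eq_bigr => y _; rewrite big_ord_recr.
rewrite big_ord_recr/= -[K.+2%:R]natr1.
have := partial_sum_subsolution K x.
have : q * s ^+ 2 * beta K x <= beta K x by rewrite ler_piMl// beta_ge0.
lra.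
Qed.

(** A crude a priori bound: powers of [avg] applied to [f] have known decay at [o], so the remainder
    of the iteration can be estimated through it. *)
Lemma cesaro_le_sum K x : b K x <= \sum_(n < K) (K%:R * (s * d%:R) ^+ n) * avgn n f x.
Proof.
apply: (@le_trans _ _ (\sum_(j < K) S K x)).
  apply: ler_sum => j _; rewrite -(big_mkord xpredT (fun n => beta n x)).
  rewrite -(big_mkord xpredT (fun n => beta n x)) [leRHS](@big_cat_nat _ _ _ j.+1)//=.
  by rewrite lerDl sumr_ge0// => i _; rewrite beta_ge0.
rewrite sumr_const card_ord -[leLHS]mulr_natl mulr_sumr; apply: ler_sum => n _.
rewrite -mulrA exprMn -mulrA ler_wpM2l// ler_wpM2l ?exprn_ge0//.
exact: nbsum_le_avgn.
Qed.

Variables (o : V) (r C t : R).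
Hypothesis r0 : 0 <= r.
Hypothesis decay : forall N, avgn N f o <= r ^+ N.
Hypothesis tE : t = s * d%:R / (1 + q * s ^+ 2).
Hypothesis tr : t * r < 1.
Hypothesis greenC : forall M, \sum_(N < M) t ^+ N * avgn N f o <= C.

Let t0 : 0 <= t.
Proof. by rewrite tE divr_ge0 ?mulr_ge0// addr_ge0// mulr_ge0// exprn_ge0. Qed.

(** By the a priori bound and [decay], the remainder after [M] iterations is at most
    [(t * r) ^+ M * D] with [D] independent of [M], so it vanishes in the limit. *)
Lemma cesaro_le K : b K o <= K.+1%:R * C.
Proof.
pose D := \sum_(n < K) K%:R * (s * d%:R) ^+ n * r ^+ n.
have D0 : 0 <= D.
  by apply: sumr_ge0 => n _; rewrite !mulr_ge0// exprn_ge0// mulr_ge0.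
have le M : b K o <= K.+1%:R * C + (t * r) ^+ M * D.
  have sub x : b K x <= t * avg (fun y => b K y) x + K.+1%:R * f x.
    by rewrite tE; exact: cesaro_subsolution.
  apply: (le_trans (subsolution_iter t0 sub M o)).
  apply: lerD; first by rewrite ler_wpM2l.
  rewrite exprMn -mulrA ler_wpM2l ?exprn_ge0//.
  apply: le_trans; first exact: (avgn_le M (cesaro_le_sum K)).
  rewrite avgn_sum /D mulr_sumr; apply: ler_sum => n _.
  rewrite -iterD [leRHS]mulrCA ler_wpM2l ?mulr_ge0 ?exprn_ge0 ?mulr_ge0//.
  by rewrite -exprD.
rewrite leNgt; apply/negP => lt.
have : (fun M => (t * r) ^+ M * D) @ \oo --> (0 : R).
  rewrite -[X in _ --> X](mul0r D); apply: cvgMr_tmp.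
  by apply: cvg_expr; rewrite ger0_norm// mulr_ge0.
move/cvgrPdist_lt => /(_ (b K o - K.+1%:R * C)).
rewrite subr_gt0 => /(_ lt)[M _ /(_ M (leqnn M))] /=.
rewrite sub0r normrN ger0_norm ?mulr_ge0 ?exprn_ge0 ?mulr_ge0//.
by have := le M; lra.
Qed.

(** [S] is nondecreasing in its length, so [K - J] terms of the Cesaro sum are at least [S J]; for
    large [K] the [J] and the [+ 1] become negligible. *)
Lemma nb_green_le J : S J o <= C.
Proof.
have le K : (K%:R - J%:R) * S J o <= K.+1%:R * C.
  case: (leqP J K) => [JK|KJ]; last first.
    apply: (@le_trans _ _ 0).
      rewrite mulr_le0_ge0//; first by rewrite subr_le0 ler_nat ltnW.
      by apply: sumr_ge0 => i _; rewrite beta_ge0.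
    by rewrite mulr_ge0//; have := greenC 0; rewrite big_ord0.
  apply: le_trans (cesaro_le K); rewrite -natrB//.
  rewrite -(big_mkord xpredT (fun j => S j.+1 o)) (@big_cat_nat _ _ _ J)//=.
  rewrite ler_wpDl//.
    by apply: sumr_ge0 => j _; apply: sumr_ge0 => i _; rewrite beta_ge0.
  rewrite mulr_natl -sumr_const_nat; apply: ler_sum_nat => j /andP[Jj _].
  rewrite -(big_mkord xpredT (fun n => beta n o)).
  rewrite -(big_mkord xpredT (fun n => beta n o)) [leRHS](@big_cat_nat _ _ _ J)//=.
    by rewrite lerDl sumr_ge0// => i _; rewrite beta_ge0.
  exact: leqW.
rewrite leNgt; apply/negP => lt.
have e0 : 0 < S J o - C by rewrite subr_gt0.
have h0 : 0 <= (J%:R * S J o + `|C|) / (S J o - C).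
  apply: divr_ge0; last exact: ltW.
  by rewrite addr_ge0// mulr_ge0// sumr_ge0// => i _; rewrite beta_ge0.
have := archi_boundP h0.
rewrite ltr_pdivrMr//; move: (Num.bound _) => K hK.
have := le K; rewrite -natr1; have := ler_norm C; lra.
Qed.

End Comparison.
End Averaging.

(** * Spectral radius and decay of the random walk *)

(** Adjoining [i] raises the right side minus the left side by [w i] times the sum of
    [w j * (y i - y j) ^+ 2]. *)
Lemma weighted_cauchy_schwarz (R : realDomainType) (I : Type) (s : seq I) (w y : I -> R) :
  (forall i, 0 <= w i) ->
  (\sum_(i <- s) w i * y i) ^+ 2 <= (\sum_(i <- s) w i) * (\sum_(i <- s) w i * y i ^+ 2).
Proof.
move=> w0; elim: s => [|i s IH]; first by rewrite !big_nil expr0n mul0r.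
rewrite !big_cons.
have : 0 <= w i * \sum_(j <- s) w j * (y i - y j) ^+ 2.
  by rewrite mulr_ge0// sumr_ge0// => j _; rewrite mulr_ge0// sqr_ge0.
have -> : \sum_(j <- s) w j * (y i - y j) ^+ 2 = (\sum_(j <- s) w j) * y i ^+ 2
    - 2 * y i * (\sum_(j <- s) w j * y j) + \sum_(j <- s) w j * y j ^+ 2.
  rewrite mulr_suml mulr_sumr -sumrB -big_split/=; apply: eq_bigr => j _; ring.
move: IH; move: (\sum_(j <- s) w j) (\sum_(j <- s) w j * y j) => W A.
move: (\sum_(j <- s) w j * y j ^+ 2) (w i) (y i) => B u v; lra.
Qed.

Lemma geometric_sum_le (R : realFieldType) (x : R) n : 0 <= x -> x < 1 ->
  \sum_(i < n) x ^+ i <= (1 - x)^-1.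
Proof.
move=> x0 x1; have x1' : 0 < 1 - x by rewrite subr_gt0.
suff h : (1 - x) * \sum_(i < n) x ^+ i = 1 - x ^+ n.
  by rewrite -(ler_pM2l x1') h divff ?gt_eqF// lerBlDr lerDl exprn_ge0.
elim: n => [|n IH]; first by rewrite big_ord0 expr0; ring.
by rewrite big_ord_recr/= mulrDr IH exprS; ring.
Qed.

Section RandomWalk.
Variables (V : choiceType) (nbrs : V -> seq V) (R : realType) (d : nat).
Hypothesis simpleG : simple_graph nbrs.
Hypothesis regG : forall x, size (nbrs x) = d.
Hypothesis d0 : (0 < d)%N.
Local Notation p n := (srw_p nbrs n : V -> V -> R).

Lemma srw_ge0 n x y : 0 <= p n x y.
Proof. by rewrite srw_pE avgn_ge0// => z. Qed.

(** A finite [F] may miss intermediate vertices, hence the inequality; this form avoids infinite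
    sums. *)
Lemma chapman_kolmogorov_le (F : seq V) m n x y : uniq F ->
  \sum_(z <- F) p m x z * p n z y <= p (m + n) x y.
Proof.
move=> uF; elim: m x => [|m IH] x /=.
  have [xF|xF] := boolP (x \in F).
    rewrite (bigD1_seq x)//= eqxx mul1r big1 ?addr0// => z zx.
    by rewrite eq_sym (negbTE zx) mul0r.
  rewrite big_seq big1 ?srw_ge0// => z zF.
  by case: (x =P z) => [xz|]; [rewrite xz zF in xF|rewrite mul0r].
under eq_bigr do rewrite mulr_suml.
rewrite exchange_big/=; apply: ler_sum => w _.
under eq_bigr do rewrite -mulrA.
by rewrite -mulr_sumr ler_wpM2l// invr_ge0.
Qed.

(** On a regular graph every step has weight [d%:R^-1], so expanding at the last step, as in [back],
    mirrors expanding at the first. *)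
Lemma srw_sym n x y : p n x y = p n y x.
Proof.
have [uG [_ sG]] := simpleG.
have back m u v : p m.+1 u v = \sum_(w <- nbrs v) d%:R^-1 * p m u w.
  elim: m u v => [|m IH] u v.
    have mem1 (s : seq V) z : uniq s -> \sum_(w <- s) (w == z)%:R = (z \in s)%:R :> R.
      by move=> us; rewrite -natr_sum -(count_sum (pred1 z)) count_uniq_mem.
    transitivity (d%:R^-1 * (v \in nbrs u)%:R : R).
      by rewrite -mem1// mulr_sumr /= regG.
    have -> : (v \in nbrs u) = (u \in nbrs v) by apply/idP/idP; apply: sG.
    by rewrite -mem1// mulr_sumr; apply: eq_bigr => w _; rewrite /= eq_sym.
  transitivity (\sum_(w <- nbrs u) (size (nbrs u))%:R^-1 * p m.+1 w v); first by [].
  under eq_bigr do rewrite IH mulr_sumr.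
  rewrite exchange_big/=; apply: eq_bigr => w _; rewrite mulr_sumr.
  by apply: eq_bigr => z _; rewrite mulrCA.
elim: n x y => [|n IH] x y; first by rewrite /= eq_sym.
by rewrite back /= regG; apply: eq_bigr => w _; rewrite IH.
Qed.

Lemma srw_sum_sqr_le (F : seq V) n x : uniq F ->
  \sum_(z <- F) p n x z ^+ 2 <= p (2 * n) x x.
Proof.
move=> uF; rewrite mul2n -addnn; apply: le_trans (chapman_kolmogorov_le n n x x uF).
by apply/ler_of_eq/eq_bigr => z _; rewrite expr2 [p n z x]srw_sym.
Qed.

Lemma srw_le1 n x y : p n x y <= 1.
Proof.
elim: n x => [|n IH] x /=; first by rewrite lern1 leq_b1.
apply: (@le_trans _ _ (\sum_(w <- nbrs x) (size (nbrs x))%:R^-1)).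
  by apply: ler_sum => w _; rewrite ler_piMr// invr_ge0.
rewrite big_const_seq count_predT iter_addr_0 regG.
by rewrite -[X in X <= _]mulr_natr mulVf// pnatr_eq0 -lt0n.
Qed.

Lemma srw_even_supermul m n x :
  p (2 * m) x x * p (2 * n) x x <= p (2 * (m + n)) x x.
Proof.
have := @chapman_kolmogorov_le [:: x] (2 * m) (2 * n) x x isT.
by rewrite big_seq1 mulnDr.
Qed.

Lemma srw_even_gt0 n x : 0 < p (2 * n) x x.
Proof.
elim: n => [|n IH]; first by rewrite muln0 /= eqxx ltr01.
rewrite -(addn1 n); apply: lt_le_trans (srw_even_supermul n 1 x).
rewrite mulr_gt0// muln1 -[2%N]/(1 + 1)%N.
case E : (nbrs x) => [|y s]; first by have := d0; rewrite -(regG x) E.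
have yx : y \in nbrs x by rewrite E mem_head.
have d1 : (0 : R) < d%:R^-1 by rewrite invr_gt0 ltr0n.
have p1 u v : v \in nbrs u -> 0 < p 1 u v.
  move=> uv; rewrite /= regG (bigD1_seq v)//=; last by case: simpleG.
  by rewrite eqxx mulr1 ltr_wpDr// sumr_ge0// => z _; rewrite mulr_ge0// ltW.
apply: lt_le_trans (@chapman_kolmogorov_le [:: y] 1 1 x x isT).
by rewrite big_seq1 mulr_gt0 ?p1//; case: simpleG => _ [_]; apply.
Qed.

(** Supermultiplicativity of the even return probabilities makes [fekete] applicable to [- ln]: the
    limit defining the spectral radius exists and dominates the root at every [n]. The [l / 2] comes
    from the exponent [1 / (2 n)]. *)
Lemma srw_even_le_spectral (rho : R) n o :
  spectral_radius nbrs o <= rho -> p (2 * n) o o <= rho ^+ (2 * n).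
Proof.
pose a n := - ln (p (2 * n) o o).
have [|m k|l [al la]] := @fekete R a.
- by move=> m; rewrite oppr_ge0 ln_le0// srw_le1.
- rewrite /a -opprD lerN2 -lnM ?posrE ?srw_even_gt0// ler_ln ?posrE ?mulr_gt0//;
    rewrite ?srw_even_gt0//; exact: srw_even_supermul.
have cv : (fun n => (p (2 * n) o o) `^ ((2 * n)%:R^-1)) @ \oo --> expR (- (l / 2)).
  have -> : (fun n => (p (2 * n) o o) `^ ((2 * n)%:R^-1)) =
      (fun n => expR (- (a n / n%:R / 2))).
    apply/funext => k; rewrite /powR gt_eqF ?srw_even_gt0//; congr expR.
    by rewrite /a natrM invfM; ring.
  apply: continuous_cvg; first exact: continuous_expR.
  by apply: cvgN; apply: cvgMr_tmp.
rewrite /spectral_radius (cvg_lim _ cv)// => le.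
have -> : p (2 * n) o o = expR (- a n) by rewrite /a opprK lnK// posrE srw_even_gt0.
apply: (@le_trans _ _ (expR (- (l / 2)) ^+ (2 * n))).
  rewrite -expRM_natl ler_expR natrM.
  have := la n; lra.
by apply: lerXn2r; rewrite ?nnegrE ?expR_ge0// (le_trans _ le)// expR_ge0.
Qed.

Section Decay.
Variables (o : V) (rho : R).
Hypothesis rho0 : 0 < rho.
Hypothesis decay : forall n, p (2 * n) o o <= rho ^+ (2 * n).

(** Symmetry bounds [p n o x ^+ 2] by the return probability in [2 * n] steps. *)
Lemma srw_le_exp n x : p n o x <= rho ^+ n.
Proof.
rewrite -(@ler_pXn2r _ 2)// ?nnegrE ?srw_ge0 ?exprn_ge0 ?(ltW rho0)//.
rewrite -exprM mulnC; apply: le_trans (decay n).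
by have := @srw_sum_sqr_le [:: x] n o isT; rewrite big_seq1.
Qed.

Variable t : R.
Hypothesis t0 : 0 <= t.
Hypothesis t1 : t * rho < 1.

Let tr0 : 0 <= t * rho. Proof. by rewrite mulr_ge0// ltW. Qed.

Lemma srw_green_partial_le M x : \sum_(n < M) t ^+ n * p n o x <= (1 - t * rho)^-1.
Proof.
apply: le_trans (geometric_sum_le M tr0 t1); apply: ler_sum => n _.
by rewrite exprMn ler_wpM2l ?exprn_ge0// srw_le_exp.
Qed.

(** Cauchy-Schwarz over time with weights [(t * rho) ^+ n]: for each [n], the squares of
    [p n o x / rho ^+ n] sum over [x] to at most 1. *)
Lemma srw_bubble_partial_le M (F : seq V) : uniq F ->
  \sum_(x <- F) (\sum_(n < M) t ^+ n * p n o x) ^+ 2 <= (1 - t * rho)^-1 ^+ 2.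
Proof.
move=> uF; pose w n : R := (t * rho) ^+ n; pose y n x := p n o x / rho ^+ n.
have w0 (n : 'I_M) : 0 <= w n by rewrite exprn_ge0.
pose G := \sum_(n < M) w n.
have G0 : 0 <= G by exact: sumr_ge0.
apply: (@le_trans _ _ (\sum_(x <- F) G * \sum_(n < M) w n * y n x ^+ 2)).
  apply: ler_sum => x _.
  have := weighted_cauchy_schwarz (index_enum 'I_M) (fun n => y n x) w0.
  apply: le_trans.
  apply/ler_of_eq; congr (_ ^+ 2); apply: eq_bigr => n _.
  by rewrite /w /y exprMn; field; rewrite gt_eqF// exprn_gt0.
rewrite -mulr_sumr exchange_big/=.
have GC : G <= (1 - t * rho)^-1 by apply: geometric_sum_le.
apply: (@le_trans _ _ (G * G)).
  rewrite ler_wpM2l//; apply: ler_sum => n _; rewrite -mulr_sumr ler_piMr//.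
  rewrite /y; under eq_bigr do rewrite expr_div_n.
  rewrite -mulr_suml ler_pdivrMr ?exprn_gt0// mul1r -exprM mulnC.
  exact: le_trans (srw_sum_sqr_le n o uF) (decay n).
by rewrite expr2 ler_pM.
Qed.

End Decay.
End RandomWalk.

(** * Concatenation of self-avoiding walks *)

Section Transitivity.
Variables (V : choiceType) (nbrs : V -> seq V).
Notation walks := (walks_from nbrs).

(** No condition is imposed at the base point: the last step may reverse the first. *)
Definition nonbacktracking_loop (w : seq V) : bool :=
  if w is x :: p then nonbacktracking w && (last x p == x) else false.

Definition nb_loops n x : nat := count nonbacktracking_loop (walks n x).

Section Automorphism.
Hypothesis simpleG : simple_graph nbrs.
Variable f : V -> V.
Hypothesis autf : graph_automorphism nbrs f.

Let injf : injective f. Proof. by case: autf => /bij_inj. Qed.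

Lemma nbrs_automorphism x : perm_eq (nbrs (f x)) (map f (nbrs x)).
Proof.
case: autf => [[g fK gK] adjf]; have [uG _] := simpleG.
apply: uniq_perm; rewrite ?map_inj_uniq// => y.
by rewrite -{1}(gK y) -[_ \in _]/(adj nbrs (f x) (f (g y))) adjf -[in RHS](gK y) mem_map.
Qed.

Lemma big_walks_automorphism (T : Type) (idx : T) (op : Monoid.com_law idx) n x F :
  \big[op/idx]_(w <- walks n (f x)) F w = \big[op/idx]_(w <- walks n x) F (map f w).
Proof.
elim: n x F => [|n IH] x F; first by rewrite !big_walks0.
rewrite !big_walksS (perm_big _ (nbrs_automorphism x)) big_map.
by apply: eq_bigr => y _; rewrite IH.
Qed.

Lemma nonbacktracking_map w : nonbacktracking (map f w) = nonbacktracking w.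
Proof.
elim: w => //= x w ->; case: w => [|y [|z w]] //=.
by rewrite (inj_eq injf).
Qed.

Lemma saw_count_automorphism n x : saw_count nbrs (f x) n = saw_count nbrs x n.
Proof.
rewrite /saw_count !count_sum big_walks_automorphism.
by apply: eq_bigr => w _; rewrite map_inj_uniq.
Qed.

Lemma nb_loops_automorphism n x : nb_loops n (f x) = nb_loops n x.
Proof.
rewrite /nb_loops !count_sum big_walks_automorphism; apply: eq_bigr => -[//|y p] _.
rewrite /nonbacktracking_loop nonbacktracking_map /=.
by rewrite last_map (inj_eq injf).
Qed.
End Automorphism.

Lemma uniq_nonbacktracking (w : seq V) : uniq w -> nonbacktracking w.
Proof.
elim: w => //= x w IH /andP[xw uw]; rewrite IH// andbT.
case: w xw {IH uw} => [|y [|z w]] //=.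
by rewrite !inE !negb_or => /and3P[].
Qed.

Lemma rcons_nonbacktracking x (p : seq V) : uniq (x :: p) -> (2 <= size p)%N ->
  nonbacktracking (x :: rcons p x).
Proof.
case: p => [|y [|z p]] //= /and4P[]; rewrite !inE !negb_or => /and3P[xy xz xp].
move=> /andP[yz yp] zp up _; rewrite xz /=.
have : uniq (y :: z :: rcons p x).
  rewrite /= rcons_uniq !inE !mem_rcons !inE !negb_or yz yp zp xp up.
  by rewrite eq_sym xy eq_sym xz.
by move/uniq_nonbacktracking.
Qed.

(** [take m.+1] and [drop m] overlap in the junction vertex, so both arguments of [F] are complete
    walks. *)
Lemma big_walksD_split m n x (F : seq V -> seq V -> nat) :
  (\sum_(w <- walks (m + n) x) F (take m.+1 w) (drop m w) =
   \sum_(u <- walks m x) \sum_(v <- walks n (last x u)) F u v)%N.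
Proof.
rewrite big_walksD; apply: eq_big_seq => u /mem_walks[p [-> sp _]].
apply: eq_big_seq => v /mem_walks[p' [-> _ _]] /=.
rewrite -[x :: p ++ p']cat_cons take_size_cat /= ?sp//; congr (F _ _).
by rewrite -cat_cons (lastI x p) cat_rcons drop_size_cat// size_belast.
Qed.

End Transitivity.

Section KeyInequality.
Variables (V : choiceType) (nbrs : V -> seq V) (c e : nat -> nat) (L : nat).
Notation walks := (walks_from nbrs).
Hypothesis simpleG : simple_graph nbrs.
Hypothesis girthG : girth_ge nbrs L.
Hypothesis cE : forall x n, saw_count nbrs x n = c n.
Hypothesis eE : forall x n, nb_loops nbrs n x = e n.

Lemma sum_uniq_walks x n : (\sum_(w <- walks n x) uniq w)%N = c n.
Proof. by rewrite -(cE x) /saw_count count_sum. Qed.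

Lemma sum_two_saws x m n :
  (\sum_(w <- walks (m + n) x) (uniq (take m.+1 w) && uniq (drop m w)) = c m * c n)%N.
Proof.
rewrite (big_walksD_split _ _ _ _ (fun u v => nat_of_bool (uniq u && uniq v))).
rewrite -(sum_uniq_walks x m) big_distrl/=; apply: eq_bigr => u _.
under eq_bigr do rewrite -mulnb.
by rewrite -big_distrr/= sum_uniq_walks.
Qed.

Lemma saw_count_submul (x : V) m n : (c (m + n) <= c m * c n)%N.
Proof.
rewrite -(sum_uniq_walks x) -(sum_two_saws x); apply: leq_sum => w _.
by case uw : (uniq w) => //; rewrite take_uniq// drop_uniq.
Qed.

(** Three consecutive pieces with no condition relating them, so that the count factorises into
    [c i * (e k * c l)]. *)
Definition loop_between (i k : nat) (w : seq V) : bool :=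
  uniq (take i.+1 w) &&
  (nonbacktracking_loop (take k.+1 (drop i w)) && uniq (drop k (drop i w))).

Lemma sum_loop_between x i k l :
  (\sum_(w <- walks (i + (k + l)) x) loop_between i k w = c i * (e k * c l))%N.
Proof.
rewrite /loop_between (big_walksD_split _ _ _ _ (fun u v => nat_of_bool
  (uniq u && (nonbacktracking_loop (take k.+1 v) && uniq (drop k v))))).
rewrite -(sum_uniq_walks x i) big_distrl/=; apply: eq_big_seq => u _.
under eq_bigr do rewrite -mulnb.
rewrite -big_distrr/=; congr (_ * _)%N.
rewrite (big_walksD_split _ _ _ _ (fun u v => nat_of_bool
  (nonbacktracking_loop u && uniq v))).
rewrite -(eE (last x u)) /nb_loops count_sum big_distrl/=; apply: eq_bigr => v _.
under eq_bigr do rewrite -mulnb.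
by rewrite -big_distrr/= sum_uniq_walks.
Qed.

(* The first repeated vertex of the concatenation closes a simple cycle through the
   junction, so it is at least as long as the girth unless it is a backtrack. *)
Lemma two_saws_cases n m x p : path (adj nbrs) x p -> size p = (n.+1 + m.+1)%N ->
  let w := x :: p in uniq (take n.+2 w) -> uniq (drop n.+1 w) ->
  [\/ uniq w, nth x w n.+2 = nth x w n
    | exists i j, [/\ (i < n.+1)%N, (j < m.+1)%N, (L <= n.+1 - i + j.+1)%N
        & loop_between i (n.+1 - i + j.+1) w]].
Proof.
move=> pw sp w u1 u2; have [|nu] := boolP (uniq w); first by constructor 1.
have sw : size w = (n + m).+3 by rewrite /= sp addSn addnS.
(* [j] will be the first index whose vertex has occurred before, and [i] the index of that earlier
   occurrence. *)
have ex : exists j, ~~ uniq (take j.+1 w).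
  by exists (size w); rewrite take_oversize.
case: (ex_minnP ex) => j nuj jmin.
have uj : uniq (take j w).
  case: j nuj jmin => [|j] nuj jmin; first by rewrite take0.
  by apply: contraNT nuj => /jmin; rewrite ltnn.
have jw : (j < size w)%N.
  by rewrite ltnNge; apply: contra nuj => jw; rewrite take_oversize ?leqW// -(take_oversize jw).
have nj : (n.+1 < j)%N.
  rewrite ltnNge; apply: contra nuj => jn.
  have -> : take j.+1 w = take j.+1 (take n.+2 w) by rewrite take_takel.
  exact: take_uniq.
pose z := nth x w j.
have zj : z \in take j w.
  by move: nuj; rewrite (take_nth x)// rcons_uniq uj andbT negbK.
pose i := index z (take j w).
have ij : (i < j)%N by move: zj; rewrite -index_mem size_takel// ltnW.
have zi : nth x w i = z by rewrite -(nth_take x ij) nth_index.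
(* The second walk is self-avoiding, so the two occurrences cannot both lie at or after the
   junction. *)
have in1 : (i < n.+1)%N.
  rewrite ltnNge; apply/negP => ni.
  have sd : size (drop n.+1 w) = (size w - n.+1)%N by rewrite size_drop.
  have := nth_uniq x (_ : (i - n.+1 < size (drop n.+1 w))%N)
    (_ : (j - n.+1 < size (drop n.+1 w))%N) u2.
  rewrite !nth_drop !subnKC ?(ltnW nj)// zi eqxx.
  by move=> h; have := h _ _; rewrite sd => /(_ _ _)/esym/eqP; lia.
pose k := (j - i)%N.
have kE : k = (n.+1 - i + (j - n.+2).+1)%N by rewrite /k; lia.
(* [i] is before and [j] after the junction, so the closed piece has at least two steps, and exactly
   two only for a backtrack. *)
have [k2|k3] : k = 2 \/ (3 <= k)%N by rewrite /k; lia.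
  constructor 2; have [-> ->] : n.+2 = j /\ n = i by move: k2; rewrite /k; lia.
  by rewrite zi.
constructor 3; exists i, (j - n.+2)%N; rewrite -kE.
have iw : (i < size w)%N by exact: ltn_trans jw.
have segE : take k.+1 (drop i w) = rcons (take k (drop i w)) z.
  by rewrite (take_nth x) ?size_drop ?ltn_sub2r// nth_drop subnKC// ltnW.
have useg : uniq (take k (drop i w)).
  by rewrite take_drop subnK ?drop_uniq// ltnW.
have sseg : size (take k (drop i w)) = k.
  by rewrite size_takel// size_drop leq_sub2r// ltnW.
have hseg : take k (drop i w) = z :: behead (take k (drop i w)).
  rewrite (drop_nth x)// zi; by case: (k) k3.
have sorted_seg : sorted (adj nbrs) (take k.+1 (drop i w)).
  by apply: take_sorted; apply: drop_sorted.
have Lk : (L <= k)%N.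
  rewrite -sseg; apply: girthG; rewrite ?sseg//.
  by move: sorted_seg; rewrite segE hseg.
split=> //; first by rewrite sw in jw; lia.
rewrite /loop_between; apply/and3P; split.
- have -> : take i.+1 w = take i.+1 (take j w) by rewrite take_takel.
  exact: take_uniq.
- rewrite segE hseg rcons_cons /nonbacktracking_loop last_rcons eqxx andbT.
  by apply: rcons_nonbacktracking; rewrite -?hseg// size_behead sseg -ltnS prednK// ltnW// ltnW.
- have -> : drop k (drop i w) = drop (j - n.+1) (drop n.+1 w).
    by rewrite !drop_drop subnK ?subnK// ltnW.
  exact: drop_uniq.
Qed.

(** Once [u] is given, the second walk must first step to the penultimate vertex of [u], which
    leaves a self-avoiding walk of length [m]. *)
Lemma sum_backtracks_le x n m :
  (\sum_(w <- walks (n.+1 + m.+1) x) (uniq (take n.+2 w) &&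
     ((nth x (drop n.+1 w) 1 == nth x (take n.+2 w) n) &&
      uniq (behead (drop n.+1 w)))) <= c n.+1 * c m)%N.
Proof.
rewrite (big_walksD_split _ _ _ _ (fun u v => nat_of_bool
  (uniq u && ((nth x v 1 == nth x u n) && uniq (behead v))))).
rewrite -(sum_uniq_walks x n.+1) big_distrl/=; apply: leq_sum => u _.
under eq_bigr do rewrite -mulnb.
rewrite -big_distrr/= leq_mul2l; apply/orP; right.
rewrite -[flatten _]/(walks m.+1 (last x u)) big_walksS.
apply: (@leq_trans (\sum_(y <- nbrs (last x u)) (y == nth x u n) * c m)%N).
  apply/eq_leq/eq_bigr => y _; rewrite -(sum_uniq_walks y m) big_distrr/=.
  by apply: eq_big_seq => w /mem_walks[p [-> _ _]]; rewrite -mulnb.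
have [uG _] := simpleG.
by rewrite -big_distrl/= -(count_sum (pred1 _)) count_uniq_mem//; case: (_ \in _); rewrite ?mul1n ?mul0n.
Qed.

(** Every pair of self-avoiding walks falls under [two_saws_cases]. The double sum is a union bound
    over the number [i] of steps before the loop and the number [j.+1] of loop steps after the
    junction. *)
Lemma saw_supermul_error (x : V) n m :
  (c n.+1 * c m.+1 <= c (n.+1 + m.+1) + c n.+1 * c m +
    \sum_(i < n.+1) \sum_(j < m.+1 | L <= n.+1 - i + j.+1)
      c i * (e (n.+1 - i + j.+1) * c (m - j)))%N.
Proof.
pose bt w := uniq (take n.+2 w) && ((nth x (drop n.+1 w) 1 == nth x (take n.+2 w) n)
  && uniq (behead (drop n.+1 w))).
pose lp w := (\sum_(i < n.+1) \sum_(j < m.+1 | L <= n.+1 - i + j.+1)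
  loop_between i (n.+1 - i + j.+1) w)%N.
apply: (@leq_trans (\sum_(w <- walks (n.+1 + m.+1) x) (uniq w + bt w + lp w))%N).
  rewrite -(sum_two_saws x) big_seq [leqRHS]big_seq.
  apply: leq_sum => w /mem_walks[p [wE sp pw]].
  case u1 : (uniq (take n.+2 w)) => //; case u2 : (uniq (drop n.+1 w)) => //=.
  rewrite wE in u1 u2; have [uw|btw|[i [j [ni mj Lij lpw]]]] := two_saws_cases pw sp u1 u2.
  - by rewrite wE uw.
  - have -> : bt w; last by rewrite addnAC addn1.
    rewrite /bt wE u1 nth_drop addn1 nth_take// btw eqxx /=.
    by rewrite -drop1 drop_uniq.
  - rewrite /lp (bigD1 (Ordinal ni))//= (bigD1 (Ordinal mj))//= wE lpw.
    by apply: leq_trans (leq_addl _ _); rewrite -addnA leq_addr.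
rewrite !big_split [X in (X + _ + _ <= _)%N](sum_uniq_walks x) -!addnA leq_add2l.
apply: leq_add.
  exact: sum_backtracks_le.
rewrite exchange_big; apply: leq_sum => i _.
rewrite exchange_big; apply: leq_sum => j _.
rewrite -(sum_loop_between x).
suff -> : (n.+1 + m.+1 = i + (n.+1 - i + j.+1 + (m - j)))%N by [].
have := ltn_ord i; have := ltn_ord j; lia.
Qed.

(** The last step cannot return to the penultimate vertex. *)
Lemma saw_count_step_le (d : nat) (x : V) n :
  (forall x, size (nbrs x) = d) -> (c n.+2 <= c n.+1 * d.-1)%N.
Proof.
move=> regG; have [uG [_ sG]] := simpleG.
apply: (@leq_trans (\sum_(w <- walks (n.+1 + 1) x) (uniq (take n.+2 w) &&
    (nth x (drop n.+1 w) 1 != nth x (take n.+2 w) n)))%N).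
  rewrite addn1 -(sum_uniq_walks x); rewrite big_seq [leqRHS]big_seq.
  apply: leq_sum => w /mem_walks[p [wE sp pw]].
  case uw : (uniq w) => //; rewrite take_uniq//= nth_drop addn1 nth_take//.
  have sw : size w = n.+3 by rewrite wE /= sp.
  have n2 : (n.+2 == n) = false by lia.
  by rewrite nth_uniq ?sw ?n2//; lia.
rewrite (big_walksD_split _ _ _ _ (fun u v => nat_of_bool
  (uniq u && (nth x v 1 != nth x u n)))).
rewrite -(sum_uniq_walks x n.+1) big_distrl big_seq [leqRHS]big_seq.
apply: leq_sum => u /mem_walks[p [uE sp pu]].
under eq_bigr do rewrite -mulnb.
rewrite -big_distrr/= leq_mul2l; apply/orP; right.
rewrite -[flatten _]/(walks 1 (last x u)) big_walksS.
under eq_bigr do rewrite big_walks0.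
rewrite -(count_sum (predC1 (nth x u n))).
have nb : nth x u n \in nbrs (last x u).
  move: sp pu; rewrite uE /= => sp pu.
  case/lastP: p sp pu {uE} => [//|p y]; rewrite size_rcons => -[<-].
  rewrite rcons_path last_rcons => /andP[_ /sG].
  by rewrite -rcons_cons nth_rcons /= ltnSn nth_last.
have := count_predC (pred1 (nth x u n)) (nbrs (last x u)).
by rewrite count_uniq_mem// nb regG add1n => <-.
Qed.

End KeyInequality.

(* [c] and [e] stand for the numbers of self-avoiding walks and of nonbacktracking loops,
   [q] for the degree minus one, and [L] for the girth. *)
Section Growth.
Variables (R : realType) (c e : nat -> R) (L : nat) (q a b C eta : R).
Hypothesis q2 : 2 <= q.
Hypothesis a0 : 0 < a.
Hypothesis b34 : 3 / 4 <= b.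
Hypothesis b1 : b < 1.
Hypothesis eta0 : 0 < eta.
Hypothesis eta1 : eta < 1.
Hypothesis etaE : a / b <= eta ^+ 2.
Hypothesis C0 : 0 <= C.
Hypothesis CL : C * eta ^+ L / (1 - eta) ^+ 2 <= (1 - b) / 2.
Hypothesis c_ge0 : forall n, 0 <= c n.
Hypothesis c0 : c 0 = 1.
Hypothesis c1 : c 1 = q + 1.
Hypothesis e_le : forall k, e k <= C * (a * q) ^+ k.
Hypothesis key : forall n m, c n.+1 * c m.+1 <= c (n.+1 + m.+1)%N + c n.+1 * c m +
  \sum_(i < n.+1) \sum_(j < m.+1 | (L <= n.+1 - i + j.+1)%N)
    c i * (e (n.+1 - i + j.+1)%N * c (m - j)%N).
Local Notation r := (b * q).

Let b0 : 0 < b. Proof. by move: b34; lra. Qed.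
Let q0 : 0 < q. Proof. exact: lt_le_trans q2. Qed.
Let r0 : 0 < r. Proof. exact: mulr_gt0. Qed.

(** Walks growing at rate [b * q] against loops at rate [a * q] leave a factor [(a / b) ^+ k], at
    most [eta ^+ (2 * k)]. One [eta ^+ k] yields [eta ^+ L], the other sums geometrically over [i]
    and [j]. Growth is a hypothesis because the estimate is used inside the induction that proves
    it. *)
Lemma loop_error_le n m :
  (forall i, (i < n.+1)%N -> r ^+ (n.+1 - i) * c i <= c n.+1) ->
  (forall j, (j < m.+1)%N -> r ^+ j.+1 * c (m - j)%N <= c m.+1) ->
  \sum_(i < n.+1) \sum_(j < m.+1 | (L <= n.+1 - i + j.+1)%N)
    c i * (e (n.+1 - i + j.+1)%N * c (m - j)%N) <= (1 - b) / 2 * (c n.+1 * c m.+1).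
Proof.
move=> hn hm.
pose D := C * eta ^+ L * (c n.+1 * c m.+1).
have D0 : 0 <= D by rewrite !mulr_ge0// exprn_ge0// ltW.
apply: (@le_trans _ _ (\sum_(i < n.+1) \sum_(j < m.+1) D * (eta ^+ (n - i) * eta ^+ j))).
  apply: ler_sum => i _; rewrite big_mkcond; apply: ler_sum => j _.
  case: ifPn => [Lij|_]; last by rewrite !mulr_ge0// exprn_ge0// ltW.
  have ni := hn i (ltn_ord i); have mj := hm j (ltn_ord j).
  set k := (n.+1 - i + j.+1)%N in Lij *.
  have -> : c i * (e k * c (m - j)%N) = e k * (c i * c (m - j)%N) by ring.
  apply: (@le_trans _ _ (C * (a * q) ^+ k * (c i * c (m - j)%N))).
    by rewrite ler_wpM2r// mulr_ge0.
  have -> : C * (a * q) ^+ k * (c i * c (m - j)%N) =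
      C * (a / b) ^+ k * ((r ^+ (n.+1 - i) * c i) * (r ^+ j.+1 * c (m - j)%N)).
    have -> : (a * q) ^+ k = (a / b) ^+ k * (r ^+ (n.+1 - i) * r ^+ j.+1).
      by rewrite -exprD -/k -exprMn mulrA divfK ?gt_eqF.
    ring.
  have -> : D * (eta ^+ (n - i) * eta ^+ j) =
      C * (eta ^+ L * eta ^+ (n - i) * eta ^+ j) * (c n.+1 * c m.+1) by rewrite /D; ring.
  apply: ler_pM.
  - by rewrite mulr_ge0// exprn_ge0// divr_ge0// ltW.
  - by rewrite !mulr_ge0// exprn_ge0// ltW.
  - rewrite ler_wpM2l//; apply: (@le_trans _ _ ((eta ^+ 2) ^+ k)).
      by rewrite lerXn2r// ?nnegrE ?exprn_ge0 ?(ltW eta0)// divr_ge0// ltW.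
    rewrite -exprM -!exprD; apply: ler_wiXn2l; rewrite ?(ltW eta0) ?(ltW eta1)//.
    rewrite /k subSn ?leq_ord// in Lij *; rewrite mul2n -addnn -addnA leq_add//.
    by rewrite addSn addnS leqW// leqW.
  - by rewrite ler_pM// mulr_ge0// exprn_ge0// ltW.
under eq_bigr do rewrite -!mulr_sumr.
rewrite -mulr_sumr -mulr_suml.
have -> : \sum_(i < n.+1) eta ^+ (n - i) = \sum_(i < n.+1) eta ^+ i.
  rewrite (reindex_inj rev_ord_inj)/=; apply: eq_bigr => i _.
  by rewrite subSS subKn// -ltnS.
have g N : 0 <= \sum_(i < N) eta ^+ i <= (1 - eta)^-1.
  by rewrite sumr_ge0 ?geometric_sum_le// ?ltW// => i _; rewrite exprn_ge0// ltW.
apply: (@le_trans _ _ (D * (1 - eta)^-1 ^+ 2)).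
  have /andP[? ?] := g n.+1; have /andP[? ?] := g m.+1.
  by rewrite ler_wpM2l// expr2 ler_pM.
have -> : D * (1 - eta)^-1 ^+ 2 = C * eta ^+ L / (1 - eta) ^+ 2 * (c n.+1 * c m.+1).
  by rewrite /D exprVn; ring.
by rewrite ler_wpM2r// mulr_ge0.
Qed.

(** Strong induction: [key] with a second walk of one step says that [q * c n.+1] is at most
    [c n.+2] plus the loop error. This error, at most [(1 - b) / 2 * (q + 1) * c n.+1], fits into
    the gap [(1 - b) * q * c n.+1]. *)
Lemma growth_step n : r * c n <= c n.+1.
Proof.
have step1 : r * c 0 <= c 1 
    by rewrite c0 c1 mulr1 ler_wpDr// ler_piMl ?(ltW q0) ?(ltW b1).
have [hq hb] := (q2, b1).
elim/ltn_ind: n => -[//|n] IH.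
have iter k : (k <= n.+1)%N -> r ^+ k * c (n.+1 - k)%N <= c n.+1.
  elim: k => [|k IHk] kn; first by rewrite mul1r subn0.
  apply: le_trans (IHk (ltnW kn)); rewrite exprSr -mulrA ler_wpM2l ?exprn_ge0 ?(ltW r0)//.
  by rewrite -(subnSK kn) IH// subSS ltnS leq_subr.
have err := @loop_error_le n 0 _ _.
have h := key n 0.
have {err} : \sum_(i < n.+1) \sum_(j < 1 | (L <= n.+1 - i + j.+1)%N)
    c i * (e (n.+1 - i + j.+1)%N * c (0 - j)%N) <= (1 - b) / 2 * (c n.+1 * c 1).
  apply: err => [i ni|j]; last by rewrite ltnS leqn0 => /eqP ->; rewrite expr1.
  by have := iter (n.+1 - i)%N (leq_subr _ _); rewrite subKn// ltnW.
move: h; rewrite c0 c1 addn1; move: (c_ge0 n.+1) (\sum_(i < n.+1) _).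
move: (c n.+1) (c n.+2) => x y x0 S h1 h2.
have : 0 <= x * ((1 - b) * (q - 2)) by rewrite !mulr_ge0//; lra.
have : 0 <= x * (1 - b) by rewrite mulr_ge0//; lra.
lra.
Qed.

Lemma growth_pow k n : (k <= n)%N -> r ^+ k * c (n - k)%N <= c n.
Proof.
elim: k => [|k IH] kn; first by rewrite mul1r subn0.
apply: le_trans (IH (ltnW kn)); rewrite exprSr -mulrA ler_wpM2l ?exprn_ge0 ?(ltW r0)//.
by rewrite -(subnSK kn) growth_step.
Qed.

(** Since [b * q >= 3 / 2], backtracks take at most 2/3 of the product and loops at most 1/8; the
    remaining 5/24 exceeds 1/6. *)
Lemma growth_supermul m n : c m * c n <= 6 * c (m + n)%N.
Proof.
have cn k := c_ge0 k; have [hq hb hb'] := And3 q2 b1 b34.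
case: m => [|m]; first by rewrite c0 mul1r add0n; have := cn n; lra.
case: n => [|n]; first by rewrite c0 mulr1 addn0; have := cn m.+1; lra.
have : \sum_(i < m.+1) \sum_(j < n.+1 | (L <= m.+1 - i + j.+1)%N)
    c i * (e (m.+1 - i + j.+1)%N * c (n - j)%N) <= (1 - b) / 2 * (c m.+1 * c n.+1).
  apply: loop_error_le => [i mi|j nj].
    by have := growth_pow (leq_subr i m.+1); rewrite subKn// ltnW.
  by have := growth_pow nj; rewrite subSS.
have := key m n; have := growth_step n; move: (cn n) (cn m.+1) (cn n.+1).
move: (c n) (c m.+1) (c n.+1) (c (m.+1 + n.+1)%N) (\sum_(i < _) _) => x y z w S x0 y0 z0 h1 h2 h3.
have h4 : 3 / 2 * x <= z.
  apply: le_trans h1. rewrite ler_wpM2r//; apply: (@le_trans _ _ (3 / 4 * 2)); first lra.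
  by rewrite ler_pM//; lra.
have : y * (3 / 2 * x) <= y * z by rewrite ler_wpM2l.
have : 0 <= y * z by exact: mulr_ge0.
have : 0 <= (b - 3 / 4) * (y * z) by rewrite mulr_ge0 ?mulr_ge0//; lra.
lra.
Qed.

End Growth.

(** * Bubble condition *)

Lemma exists_exp_le (R : realType) (x K eps : R) : 0 <= x -> x < 1 -> 0 < eps ->
  exists2 n, (0 < n)%N & K * x ^+ n <= eps.
Proof.
move=> x0 x1 e0.
have : (fun n => K * x ^+ n) @ \oo --> (0 : R).
  rewrite -[X in _ --> X](mulr0 K); apply: cvgMl_tmp.
  by apply: cvg_expr; rewrite ger0_norm.
move/cvgrPdist_le => /(_ _ e0)[n _ /(_ n.+1 (leqnSn n))] /=.
by rewrite sub0r normrN => h; exists n.+1 => //; exact: le_trans (ler_norm _) h.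
Qed.

Lemma cvg_div_ln (R : realType) (u : nat -> R) (K : R) : (forall n, `|u n| <= K) ->
  (fun n => u n / ln n%:R) @ \oo --> (0 : R).
Proof.
move=> uK; apply/cvgrPdist_le => eps e0.
have K0 : 0 <= K by exact: le_trans (uK 0%N).
have h0 : 0 <= expR (K / eps) by exact: expR_ge0.
have := archi_boundP h0; set N := Num.bound _ => hN.
(* The shift by two also forces [1 < n], so that [ln n%:R] is positive. *)
exists N.+2 => // n /= Nn; rewrite sub0r normrN.
have nN : expR (K / eps) <= n%:R.
  by apply: ltW; apply: lt_le_trans hN _; rewrite ler_nat (leq_trans _ Nn)// leqW.
have n1 : (1 : R) < n%:R by rewrite ltr1n (leq_trans _ Nn).
have lnK : K / eps <= ln n%:R by rewrite -ler_expR lnK// posrE (lt_trans _ n1).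
have ln0 : 0 < ln (n%:R : R) by exact: ln_gt0.
rewrite normrM normfV (gtr0_norm ln0) ler_pdivrMr//; apply: le_trans (uK n) _.
by rewrite mulrC -ler_pdivrMr.
Qed.

(** * Transitive graphs: regularity, and degree at least three *)

Section SelfAvoidingWalk.
Variables (V : choiceType) (nbrs : V -> seq V) (R : realType) (o : V).
Hypothesis simpleG : simple_graph nbrs.
Hypothesis transG : transitive_graph nbrs.
Local Notation d := (size (nbrs o)).
Local Notation c n := (saw_count nbrs o n).
Local Notation walks := (walks_from nbrs).
Local Notation delta v := (fun z : V => (z == v)%:R : R).

Lemma transitive_regular x : size (nbrs x) = d.
Proof.
have [f [autf <-]] := transG o x.
by rewrite (perm_size (nbrs_automorphism simpleG autf _)) size_map.
Qed.

Lemma transitive_saw_count x n : saw_count nbrs x n = c n.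
Proof. by have [f [autf <-]] := transG o x; exact: saw_count_automorphism. Qed.

Lemma transitive_nb_loops x n : nb_loops nbrs n x = nb_loops nbrs n o.
Proof. by have [f [autf <-]] := transG o x; exact: nb_loops_automorphism. Qed.

Lemma saw_count1 : c 1 = d.
Proof.
rewrite /saw_count count_sum big_walksS.
under eq_bigr do rewrite big_walks0.
rewrite -sum1_size big_seq [RHS]big_seq; apply: eq_bigr => y oy /=.
case: (o =P y) => [oE|/eqP oy']; last by rewrite inE oy'.
by case: simpleG => _ [/(_ o)]; rewrite {1}oE oy.
Qed.

Lemma nbsum_delta n v : nbsum nbrs (delta v) n o =
  (count (fun w => nonbacktracking w && (last o w == v)) (walks n o))%:R.
Proof.
rewrite /nbsum big_mkcond count_sum natr_sum; apply: eq_bigr => w _.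
by case: ifP.
Qed.

Lemma saw_count_to_le n v : (saw_count_to nbrs o n v)%:R <= nbsum nbrs (delta v) n o.
Proof.
rewrite nbsum_delta ler_nat; apply: sub_count => w /andP[/uniq_nonbacktracking -> ->].
by [].
Qed.

Lemma nb_loops_nbsum n : (nb_loops nbrs n o)%:R = nbsum nbrs (delta o) n o.
Proof.
rewrite nbsum_delta /nb_loops; congr (_%:R); apply: eq_in_count.
by move=> w /mem_walks[p [-> _ _]].
Qed.

Lemma srw_mass n x (S : seq V) : (0 < d)%N -> uniq S ->
  (forall p, path (adj nbrs) x p -> size p = n -> last x p \in S) ->
  \sum_(y <- S) (srw_p nbrs n x y : R) = 1.
Proof.
move=> d0 uS; elim: n x => [|n IH] x h.
  rewrite (bigD1_seq x)//=; last exact: (h [::]).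
  by rewrite eqxx big1 ?addr0// => y; rewrite eq_sym => /negbTE ->.
transitivity (\sum_(w <- nbrs x) (size (nbrs x))%:R^-1 * \sum_(y <- S) srw_p nbrs n w y : R).
  by under [RHS]eq_bigr do rewrite mulr_sumr; rewrite exchange_big.
rewrite big_seq (eq_bigr (fun => d%:R^-1)); last first.
  move=> w xw; rewrite IH ?mulr1 ?transitive_regular// => p wp sp.
  by apply: (h (w :: p)); rewrite /= ?sp// /adj xw.
rewrite -big_seq big_const_seq count_predT iter_addr_0 transitive_regular.
by rewrite -[LHS]mulr_natr mulVf// pnatr_eq0 -lt0n.
Qed.

Section SmallDegree.
Variable rho : R.
Hypothesis d0 : (0 < d)%N.
Hypothesis rho0 : 0 < rho.
Hypothesis rho1 : rho < 1.
Hypothesis decay : forall n, srw_p nbrs (2 * n) o o <= rho ^+ (2 * n).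

(* In degree at most two balls grow linearly, so by Cauchy-Schwarz the return
   probabilities decay only polynomially. *)
Lemma degree_ge3 : (3 <= d)%N.
Proof.
rewrite leqNgt; apply/negP => d3.
have c2 n : (c n.+1 <= 2)%N.
  elim: n => [|n IH]; first by rewrite saw_count1.
  apply: leq_trans (saw_count_step_le simpleG transitive_saw_count o n transitive_regular) _.
  apply: leq_trans IH; rewrite -[leqRHS]muln1 leq_mul2l -subn1 leq_subLR.
  by rewrite -ltnS d3 orbT.
(* [S n] is the ball of radius [n]: shortening a path to a self-avoiding one keeps its endpoint. *)
pose S n := undup (flatten [seq map (last o) [seq w <- walks k o | uniq w] | k <- iota 0 n.+1]).
have sizeS n : (size (S n) <= 2 * n.+1)%N.
  apply: leq_trans (size_undup _) _; rewrite size_flatten /shape -map_comp sumnE big_map.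
  apply: (@leq_trans (\sum_(k <- iota 0 n.+1) 2)%N).
    apply: leq_sum => k _; rewrite /= size_map size_filter -/(saw_count nbrs o k).
    by case: k => [|k].
  by rewrite big_const_seq count_predT iter_addn_0 size_iota.
have massS n : \sum_(y <- S n) (srw_p nbrs n o y : R) = 1.
  apply: srw_mass => //; first exact: undup_uniq.
  move=> p op sp; rewrite mem_undup; case: (shortenP op) => p' op' up' sub.
  apply/flatten_mapP; exists (size p').
    rewrite mem_iota add0n ltnS /= -sp; apply: uniq_leq_size => //.
    by case/andP: up'.
  apply/mapP; exists (o :: p') => //.
  by rewrite mem_filter up' walks_mem.
have le n : 1 <= (2 * n.+1)%:R * rho ^+ (2 * n).
  have := @weighted_cauchy_schwarz R _ (S n) (fun=> 1) (fun y => srw_p nbrs n o y) (fun=> ler01).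
  under eq_bigr do rewrite mul1r.
  under [X in _ <= _ * X]eq_bigr do rewrite mul1r.
  rewrite massS expr1n big_const_seq count_predT iter_addr_0 => /le_trans; apply.
  apply: ler_pM; rewrite ?ler_nat//; first by apply: sumr_ge0 => y _; exact: sqr_ge0.
  apply: le_trans (decay n).
  exact: (srw_sum_sqr_le R simpleG transitive_regular n o (undup_uniq _)).
(* One factor [rho ^+ n] absorbs the linear growth of the ball; the other is left to give a
   contradiction for large [n]. *)
have lin n : n.+1%:R * rho ^+ n <= (1 - rho)^-1.
  apply: le_trans (geometric_sum_le n.+1 (ltW rho0) rho1).
  rewrite mulr_natl -[X in _ *+ X](card_ord n.+1) -sumr_const; apply: ler_sum => i _.
  by apply: ler_wiXn2l; rewrite ?(ltW rho0) ?(ltW rho1)// -ltnS.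
have half_gt0 : (0 : R) < 1 / 2 by rewrite divr_gt0.
have [n n0] := exists_exp_le (2 * (1 - rho)^-1) (ltW rho0) rho1 half_gt0.
have := le n; rewrite natrM mul2n -addnn exprD.
have : 0 <= rho ^+ n by rewrite exprn_ge0// ltW.
have := lin n; move: (rho ^+ n) (_^-1) (n.+1%:R) => x K N h1 x0 h2 h3.
have : N * x * x <= K * x by rewrite ler_wpM2r.
lra.
Qed.

End SmallDegree.
End SelfAvoidingWalk.

(** * Loop and bubble bounds at the parameter [s], uniform in the degree *)

Section Estimates.
Variables (V : choiceType) (nbrs : V -> seq V) (R : realType) (o : V).
Hypothesis simpleG : simple_graph nbrs.
Hypothesis transG : transitive_graph nbrs.
Local Notation d := (size (nbrs o)).
Local Notation q := ((d.-1)%:R : R).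
Local Notation delta v := (fun z : V => (z == v)%:R : R).
Variables (rho a : R).
Hypothesis d3 : (3 <= d)%N.
Hypothesis rho0 : 0 < rho.
Hypothesis rhoa : rho < a.
Hypothesis a34 : 3 / 4 <= a.
Hypothesis a1 : a < 1.
Hypothesis decay : forall n, srw_p nbrs (2 * n) o o <= rho ^+ (2 * n).
Let s : R := (a * q)^-1.
Let t : R := s * d%:R / (1 + q * s ^+ 2).
Local Notation green M v := (\sum_(n < M) t ^+ n * srw_p nbrs n o v).

Let regG x : size (nbrs x) = d. Proof. exact: transitive_regular. Qed.

Let d0 : (0 < d)%N. Proof. exact: leq_trans d3. Qed.

Let a0 : 0 < a. Proof. exact: lt_trans rhoa. Qed.

Lemma degree_pred_ge2 : 2 <= q.
Proof. by rewrite ler_nat -ltnS prednK. Qed.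

Let q0 : 0 < q. Proof. exact: lt_le_trans degree_pred_ge2. Qed.

Let s0 : 0 < s. Proof. by rewrite invr_gt0 mulr_gt0. Qed.

Let qsE : q * s ^+ 2 = (a ^+ 2 * q)^-1.
Proof. by rewrite /s; field; rewrite !gt_eqF. Qed.

(** The bound [3 / 4 <= a] serves here: with [2 <= q] it gives [a ^+ 2 * q >= 9 / 8]. *)
Let qs1 : q * s ^+ 2 <= 1.
Proof.
rewrite qsE invf_le1 ?mulr_gt0 ?exprn_gt0//.
apply: (@le_trans _ _ ((3 / 4) ^+ 2 * 2)); first by lra.
by rewrite ler_pM ?exprn_ge0 ?degree_pred_ge2// lerXn2r ?nnegrE ?(ltW a0).
Qed.

Let t0 : 0 <= t.
Proof. by rewrite divr_ge0 ?mulr_ge0 ?(ltW s0)// addr_ge0// mulr_ge0 ?exprn_ge0 ?(ltW s0). Qed.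

(** This reduces to [1 + 1 / q <= 1 + 1 / (a ^+ 2 * q)]. The bound is free of the degree, which lets
    the girth be chosen from [rho] alone. *)
Let t_le : t <= a^-1.
Proof.
have q1 : d%:R = q + 1 by rewrite natr1 prednK.
rewrite /t qsE ler_pdivrMr ?addr_gt0 ?invr_gt0 ?mulr_gt0 ?exprn_gt0//.
rewrite /s invfM -mulrA ler_pM2l ?invr_gt0// q1 mulrDr mulVf ?gt_eqF// mulr1 lerD2l.
rewrite invfM ler_peMl ?invr_ge0 ?(ltW q0)// invf_ge1 ?exprn_gt0//.
by rewrite exprn_ile1// ltW.
Qed.

Let t_rho : t * rho <= rho / a.
Proof. by rewrite mulrC ler_wpM2l// ltW. Qed.

Let rhoa1 : rho / a < 1. Proof. by rewrite ltr_pdivrMr// mul1r. Qed.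

Let t_rho1 : t * rho < 1. Proof. exact: le_lt_trans rhoa1. Qed.

Lemma nb_partial_sum_le v C J : (forall M, green M v <= C) ->
  \sum_(n < J) s ^+ n * nbsum nbrs (delta v) n o <= C.
Proof.
move=> gC.
have delta0 x : 0 <= delta v x by [].
have dec N : iter N (avg nbrs (R := R)) (delta v) o <= rho ^+ N.
  by rewrite -srw_pE; exact: (srw_le_exp simpleG regG rho0 decay).
have gC' M : \sum_(N < M) t ^+ N * iter N (avg nbrs (R := R)) (delta v) o <= C.
  by under eq_bigr do rewrite -srw_pE.
have tE : t = s * d%:R / (1 + q * s ^+ 2) by [].
exact: (nb_green_le simpleG regG d0 delta0 (ltW s0) qs1 (ltW rho0) dec tE t_rho1 gC').
Qed.

Lemma nb_loops_le k : (nb_loops nbrs k o)%:R <= (1 - rho / a)^-1 * (a * q) ^+ k.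
Proof.
have nb0 n : 0 <= nbsum nbrs (delta o) n o by apply: nbsum_ge0.
have : \sum_(n < k.+1) s ^+ n * nbsum nbrs (delta o) n o <= (1 - rho / a)^-1.
  apply: nb_partial_sum_le => M.
  apply: (@le_trans _ _ (1 - t * rho)^-1).
    exact: (srw_green_partial_le simpleG regG rho0 decay).
  by rewrite lef_pV2 ?posrE ?subr_gt0// lerD2l lerN2.
rewrite big_ord_recr/= => h.
rewrite nb_loops_nbsum -ler_pdivrMr ?exprn_gt0 ?mulr_gt0// mulrC -exprVn.
apply: le_trans h; rewrite lerDr sumr_ge0// => i _.
by rewrite mulr_ge0 ?exprn_ge0 ?(ltW s0).
Qed.

(** The random walk Green function at [t]: the best constant that [nb_partial_sum_le] can take at
    each [v], and square-summable over [v]. *)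
Let U v : R := limn (fun M => green M v).

Let green_homo v : nondecreasing_seq (fun M => green M v).
Proof.
apply/nondecreasing_seqP => n; rewrite big_ord_recr/= lerDl.
by rewrite mulr_ge0 ?exprn_ge0 ?srw_ge0.
Qed.

Let green_cvg v : (fun M => green M v) @ \oo --> U v.
Proof.
apply: nondecreasing_is_cvgn; first exact: green_homo.
exists (1 - t * rho)^-1 => _ [M _ <-].
exact: (srw_green_partial_le simpleG regG rho0 decay).
Qed.

Let green_le v M : green M v <= U v.
Proof.
have cv : cvgn (fun M => green M v) by apply: cvgP; exact: green_cvg.
exact: (nondecreasing_cvgn_le (@green_homo v) cv).
Qed.

Let sum_U_le (F : seq V) : uniq F -> \sum_(v <- F) U v ^+ 2 <= (1 - t * rho)^-1 ^+ 2.
Proof.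
move=> uF.
have cv : (fun M => \sum_(v <- F) green M v ^+ 2) @ \oo --> \sum_(v <- F) U v ^+ 2.
  elim: F {uF} => [|v F IH].
    by rewrite big_nil; under eq_fun do rewrite big_nil; exact: cvg_cst.
  rewrite big_cons; under eq_fun do rewrite big_cons.
  by apply: cvgD => //; rewrite expr2; under eq_fun do rewrite expr2; apply: cvgM.
rewrite -(cvg_lim _ cv)//; apply: limr_le; first exact: cvgP cv.
apply: nearW => M.
exact: (srw_bubble_partial_le simpleG regG).
Qed.

Let green_term_ge0 (z : R) v n : 0 <= z -> (0 <= ((saw_count_to nbrs o n v)%:R * z ^+ n)%:E)%E.
Proof. by move=> z0; rewrite lee_fin mulr_ge0// exprn_ge0. Qed.

Lemma saw_green_ge0 (z : R) v : 0 <= z -> (0 <= saw_green nbrs o z v)%E.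
Proof. by move=> z0; apply: nneseries_ge0 => n _ _; exact: green_term_ge0. Qed.

Let saw_green_le (z : R) v : 0 <= z -> z <= s -> (saw_green nbrs o z v <= (U v)%:E)%E.
Proof.
move=> z0 zs; apply: lime_le.
  by apply: is_cvg_nneseries => n _ _; exact: green_term_ge0.
apply: nearW => J; rewrite sumEFin lee_fin big_mkord.
apply: le_trans (nb_partial_sum_le J (green_le v)); apply: ler_sum => n _.
rewrite mulrC ler_pM ?exprn_ge0//; first by rewrite lerXn2r ?nnegrE ?(ltW s0).
exact: saw_count_to_le.
Qed.

Lemma saw_bubble_ge0 (z : R) : 0 <= z -> (0 <= saw_bubble nbrs o z)%E.
Proof. by move=> z0; apply: esum_ge0 => v _; rewrite mule_ge0 ?saw_green_ge0. Qed.

Lemma saw_bubble_homo (y z : R) : 0 <= y -> y <= z ->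
  (saw_bubble nbrs o y <= saw_bubble nbrs o z)%E.
Proof.
move=> y0 yz; apply: le_esum => v _.
have le : (saw_green nbrs o y v <= saw_green nbrs o z v)%E.
  apply: lee_nneseries => [n _ _|n _]; first exact: green_term_ge0.
  by rewrite lee_fin ler_wpM2l// lerXn2r ?nnegrE ?y0 ?(le_trans y0 yz).
by apply: lee_pmul => //; exact: saw_green_ge0.
Qed.

Let saw_bubble_le (z : R) : 0 <= z -> z <= s ->
  (saw_bubble nbrs o z <= ((1 - t * rho)^-1 ^+ 2)%:E)%E.
Proof.
move=> z0 zs; apply: ub_ereal_sup => _ [A [fA _] <-].
rewrite fsbig_finite//=.
apply: (@le_trans _ _ (\sum_(v <- finmap.enum_fset (fset_set A)) (U v ^+ 2)%:E)%E).
  apply: lee_sum => v _; rewrite expr2 EFinM.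
  by apply: lee_pmul; rewrite ?saw_green_ge0 ?saw_green_le.
by rewrite sumEFin lee_fin sum_U_le// finmap.fset_uniq.
Qed.

(** The bubble is nondecreasing in [z] and bounded up to [s], so it has a finite left limit at a
    critical point not exceeding [s]. Positivity of the critical point keeps nearby [z]
    nonnegative. *)
Lemma saw_bubble_condition_below : (0 : R) < (connective_constant nbrs o)^-1 ->
  (connective_constant nbrs o)^-1 <= (a * q)^-1 -> saw_bubble_condition (R:=R) nbrs o.
Proof.
rewrite /saw_bubble_condition; move: (connective_constant nbrs o)^-1 => p p0 ps.
have fin z : 0 <= z -> z <= s -> saw_bubble nbrs o z \is a fin_num.
  by move=> z0 zs; rewrite ge0_fin_numE ?saw_bubble_ge0// (le_lt_trans (saw_bubble_le z0 zs)) ?ltry.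
have cv : cvg ((fine \o saw_bubble nbrs o) z @[z --> p^'-]).
  apply: nondecreasing_at_left_is_cvgr.
    near=> x => y z; rewrite !in_itv/= => /andP[xy yp] /andP[xz zp] yz.
    have x0 : 0 <= x by near: x; exact: nbhs_left_ge.
    have [y0 z0] := (le_trans x0 (ltW xy), le_trans x0 (ltW xz)).
    by rewrite fine_le ?fin ?saw_bubble_homo// (le_trans _ ps)// ltW.
  near=> x; exists ((1 - t * rho)^-1 ^+ 2) => _ [y /= + <-].
  rewrite in_itv/= => /andP[xy yp].
  have x0 : 0 <= x by near: x; exact: nbhs_left_ge.
  have y0 := le_trans x0 (ltW xy); have ys := le_trans (ltW yp) ps.
  by rewrite -lee_fin fineK ?fin// saw_bubble_le.
have /cvg_ex[l hl] := cv.
exists l; apply/fine_cvgP; split=> //.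
near=> z; apply: fin; first by near: z; exact: nbhs_left_ge.
by apply: le_trans ps; near: z; exact: nbhs_left_le.
Unshelve. all: by end_near. Qed.

End Estimates.

(** * The exponent gamma *)

Section Asymptotics.
Variables (V : choiceType) (nbrs : V -> seq V) (R : realType) (o : V) (r K : R).
Local Notation c n := (saw_count nbrs o n).
Local Notation mu := (connective_constant nbrs o : R).
Hypothesis r1 : 1 <= r.
Hypothesis c_growth : forall n, r * (c n)%:R <= (c n.+1)%:R.
Hypothesis c_submul : forall m n, (c (m + n) <= c m * c n)%N.
Hypothesis c_supermul : forall m n, (c m)%:R * (c n)%:R <= K * (c (m + n))%:R.

Let r0 : 0 < r. Proof. exact: lt_le_trans r1. Qed.

Let c_ge n : r ^+ n <= (c n)%:R.
Proof.
elim: n => [|n IH]; first by rewrite expr0 ler1n.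
by apply: le_trans (c_growth n); rewrite exprS ler_wpM2l// ltW.
Qed.

Let c_ge1 n : (1 : R) <= (c n)%:R.
Proof. by apply: le_trans (c_ge n); rewrite exprn_ege1. Qed.

Let c_gt0 n : (0 : R) < (c n)%:R. Proof. exact: lt_le_trans (c_ge1 n). Qed.

Let K1 : 1 <= K.
Proof. by have := c_supermul 0 0; rewrite !mulr1. Qed.

(** By submultiplicativity and [fekete], the limit defining [mu] exists and [mu ^+ n] is at most
    [c n]; supermultiplicativity up to [K] gives [c n] at most [K * mu ^+ n]. *)
Lemma connective_constant_spec : r <= mu /\
  forall n, 0 <= ln ((c n)%:R / mu ^+ n) <= ln K.
Proof.
pose a n : R := ln (c n)%:R.
have [|m n|l [al la]] := @fekete R a.
- by move=> n; rewrite ln_ge0.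
- rewrite /a -lnM ?posrE// ler_ln ?posrE ?mulr_gt0//.
  by rewrite -natrM ler_nat.
have muE : mu = expR l.
  apply: cvg_lim => //.
  have -> : (fun n => ((c n)%:R : R) `^ n%:R^-1) = (fun n => expR (a n / n%:R)).
    by apply/funext => n; rewrite /powR gt_eqF// mulrC.
  by apply: continuous_cvg => //; exact: continuous_expR.
have aK n : a n <= n%:R * l + ln K.
  apply: superadditive_le_rate al n => m n.
  rewrite /a -!lnM ?posrE ?mulr_gt0//; last exact: lt_le_trans K1.
  rewrite ler_ln ?posrE ?mulr_gt0//; last exact: lt_le_trans K1.
  by rewrite mulrC [leRHS]mulrC mulrC.
split=> [|n].
  rewrite muE -ler_ln ?posrE ?expR_gt0// expRK.
  have h : \forall n \near \oo, ln r <= a n / n%:R.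
    exists 1%N => // n /= n1; rewrite ler_pdivlMr ?ltr0n// mulrC.
    rewrite mulr_natl -lnXn//.
    by rewrite ler_ln ?posrE ?exprn_gt0.
  by rewrite -(cvg_lim _ al)//; apply: limr_ge h; exact: cvgP al.
rewrite muE -expRM_natl ln_div ?posrE ?expR_gt0// expRK -/(a n).
by have := la n; have := aK n; lra.
Qed.

Lemma saw_gamma_is1 : saw_gamma_is nbrs o (1 : R).
Proof.
have [_ spec] := connective_constant_spec.
rewrite /saw_gamma_is -[X in _ --> X](add0r 1); apply: cvgD; last exact: cvg_cst.
apply: (@cvg_div_ln _ _ (ln K)) => n; have /andP[h0 h1] := spec n.
by rewrite ger0_norm.
Qed.

End Asymptotics.

(** * Choice of constants and conclusion *)

Theorem theorem1p4 (R : realType) (rho : R) (hrho : rho < 1) :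
  exists L : nat, (0 < L)%N /\
    forall (V : choiceType) (nbrs : V -> seq V) (o : V),
      simple_graph nbrs -> connected_graph nbrs -> infinite_graph V ->
      transitive_graph nbrs ->
      spectral_radius nbrs o <= rho ->
      girth_ge nbrs L ->
      saw_bubble_condition (R:=R) nbrs o /\ saw_gamma_is nbrs o (1 : R).
Proof.
(* [rho] may be small or negative; the maximum gives positivity and the bound [3 / 4] for [a] and
   [b]. *)
pose r := Num.max rho (3 / 4).
have r34 : 3 / 4 <= r by rewrite le_max lexx orbT.
have r1 : r < 1 by rewrite gt_max hrho; lra.
have r0 : 0 < r by lra.
(* The numbers [r], [a], [b], 1 are equally spaced. *)
pose a := (2 * r + 1) / 3; pose b := (r + 2) / 3.
have ra : r < a by rewrite /a; lra.
have ab : a < b by rewrite /a /b; lra.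
have b1 : b < 1 by rewrite /b; lra.
have a34 : 3 / 4 <= a by lra.
have b34 : 3 / 4 <= b by lra.
have a0 : 0 < a by lra.
have b0 : 0 < b by lra.
pose C := (1 - r / a)^-1.
have C0 : 0 <= C by rewrite invr_ge0 subr_ge0 ler_pdivrMr// mul1r ltW.
(* The midpoint of [a / b] and 1 is below 1, and its square dominates [a / b] by the
   arithmetic-geometric mean inequality. *)
pose eta := (1 + a / b) / 2.
have theta0 : 0 < a / b by exact: divr_gt0.
have theta1 : a / b < 1 by rewrite ltr_pdivrMr// mul1r.
have eta0 : 0 < eta by rewrite /eta; lra.
have eta1 : eta < 1 by rewrite /eta; lra.
have etaE : a / b <= eta ^+ 2.
  rewrite -subr_ge0 (_ : _ - _ = ((1 - a / b) / 2) ^+ 2) ?sqr_ge0//.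
  by rewrite /eta; field; rewrite gt_eqF.
have eps0 : 0 < (1 - b) / 2 by lra.
(* [L] depends on [rho] only and brings the relative loop error down to half of [1 - b]. *)
have [L L0 CL] := exists_exp_le (C / (1 - eta) ^+ 2) (ltW eta0) eta1 eps0.
rewrite mulrAC in CL.
exists L; split=> // V nbrs o simpleG connG infG transG spec girthG.
have regG x : size (nbrs x) = size (nbrs o) by exact: transitive_regular.
(* Some vertex differs from [o], and a path from [o] to it begins with a neighbour of [o]. *)
have d0 : (0 < size (nbrs o))%N.
  have [x] := infG [:: o]; rewrite inE.
  have [[|y p] [/= pp <-]] := connG o x; first by rewrite eqxx.
  by move: pp; rewrite /adj; case: (nbrs o).
have decay n : srw_p nbrs (2 * n) o o <= r ^+ (2 * n).
  apply: (srw_even_le_spectral simpleG regG d0); apply: le_trans spec _.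
  by rewrite le_max lexx.
have d3 := degree_ge3 simpleG transG d0 r0 r1 decay.
pose q : R := (size (nbrs o)).-1%:R.
have q2 : 2 <= q by apply: degree_pred_ge2.
have c1 : (saw_count nbrs o 1)%:R = q + 1 by rewrite saw_count1// natr1 prednK.
have e_le k : (nb_loops nbrs k o)%:R <= C * (a * q) ^+ k.
  by apply: nb_loops_le; rewrite // (lt_trans ab b1).
have key n m : (saw_count nbrs o n.+1)%:R * (saw_count nbrs o m.+1)%:R <=
    (saw_count nbrs o (n.+1 + m.+1))%:R
    + (saw_count nbrs o n.+1)%:R * (saw_count nbrs o m)%:R
    + \sum_(i < n.+1) \sum_(j < m.+1 | (L <= n.+1 - i + j.+1)%N)
        (saw_count nbrs o i)%:R * ((nb_loops nbrs (n.+1 - i + j.+1) o)%:R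
          * (saw_count nbrs o (m - j))%:R) :> R.
  have := saw_supermul_error simpleG girthG (transitive_saw_count o simpleG transG)
    (transitive_nb_loops o simpleG transG) o n m.
  rewrite -(ler_nat R) !natrD !natrM natr_sum => /le_trans; apply.
  rewrite lerD2l; apply: ler_sum => i _; rewrite natr_sum; apply: ler_sum => j _.
  by rewrite !natrM.
have c_ge0 n : 0 <= (saw_count nbrs o n)%:R :> R by [].
have c_growth := growth_step q2 a0 b34 b1 eta0 eta1 etaE C0 CL c_ge0 erefl c1 e_le key.
have c_super := growth_supermul q2 a0 b34 b1 eta0 eta1 etaE C0 CL c_ge0 erefl c1 e_le key.
have c_sub := saw_count_submul (transitive_saw_count o simpleG transG) o.
have bq1 : 1 <= b * q.
  apply: (@le_trans _ _ (3 / 4 * 2)); first by lra.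
  by rewrite ler_pM.
have [mu_ge _] := connective_constant_spec bq1 c_growth c_sub c_super.
have q0 : 0 < q by exact: lt_le_trans q2.
have mu0 : 0 < connective_constant nbrs o :> R by apply: lt_le_trans mu_ge; exact: mulr_gt0.
split; last exact: saw_gamma_is1 bq1 c_growth c_sub c_super.
apply: (saw_bubble_condition_below simpleG transG d3 r0 ra a34 _ decay).
- exact: lt_trans b1.
- by rewrite invr_gt0.
(* The growth rate gives [b * q <= mu], and [a < b], so the critical point is at most
   [(a * q)^-1]. *)
- rewrite lef_pV2 ?posrE//; last exact: mulr_gt0 a0 q0.
  apply: le_trans mu_ge.
  by rewrite ler_wpM2r// ltW.
Qed.
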